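(* Let $n_0,n_1\ge0$ be integers and $n=n_0+2n_1$. Let $A_n=(a_{\lambda\mu})_{\lambda,\mu\in P_n}$ be defined by $$S_\lambda(x,x)=\sum_{\mu\in P_n}a_{\lambda\mu}\,Q_{\mu^r}(x)\,S_{\mu^d}(x^2)\qquad(\lambda\in P_n),$$ and let $B_{n_0,n_1}$ be the block of ${}^tA_nA_n$ with rows and columns indexed by $P_{n_0,n_1}$. Then $$|\det B_{n_0,n_1}|=2^{\sum_{\lambda\in P_{n_0,n_1}}\left(\ell(\widetilde{\lambda^r})+\ell(\lambda^d)-\ell(\lambda^r)\right)}.$$
   Context: $P_n$ is the set of partitions of $n$; $\ell(\lambda)$ is the number of parts of $\lambda$. For a partition $\lambda$ let $m_i(\lambda)$ be the multiplicity of $i$ as a part of $\lambda$. Define $\lambda^r$ to be the strict partition (distinct parts) with $m_i(\lambda^r)=1$ if $m_i(\lambda)$ is odd and $0$ if $m_i(\lambda)$ is even. Define $\lambda^d$ to be the partition with $m_i(\lambda^d)=\frac12(m_i(\lambda)-1)$ if $m_i(\lambda)$ is odd and $\frac12 m_i(\lambda)$ if $m_i(\lambda)$ is even. The map $\lambda\mapsto(\lambda^r,\lambda^d)$ is a bijection from $P_n$ to the union over $n_0+2n_1=n$ of (strict partitions of $n_0$) $\times$ (partitions of $n_1$). $P_{n_0,n_1}$ denotes the set of $\lambda\in P_n$ such that $\lambda^r$ is a partition of $n_0$ and $\lambda^d$ is a partition of $n_1$. The matrix ${}^tA_nA_n$ is block diagonal with respect to the decomposition of $P_n$ into the sets $P_{n_0,n_1}$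 ($n_0+2n_1=n$), and $B_{n_0,n_1}$ denotes the corresponding diagonal block. Glaisher map: for a strict partition $\lambda=(\lambda_1,\lambda_2,\ldots)$ of $m$ with $\lambda_i=2^{p_i}q_i$, $q_i$ odd, $\widetilde\lambda$ is the partition of $m$ into odd parts with $m_{2j-1}(\widetilde\lambda)=\sum_{i:\,q_i=2j-1}2^{p_i}$ for $j\geq 1$. $S_\nu(x)$ is the ordinary Schur function in $x=(x_1,x_2,\ldots)$. We write $(x,x)=(x_1,x_1,x_2,x_2,\ldots)$ and $x^2=(x_1^2,x_2^2,\ldots)$; thus $S_\lambda(x,x)$ is obtained from $S_\lambda$ by replacing each power sum $p_j$ by $2p_j(x)$, and $S_\nu(x^2)$ by replacing each $p_j$ by $p_{2j}(x)$. For a strict partition $\mu$, $Q_\mu(x)$ is Schur's $Q$-function (the Hall–Littlewood function $Q_\mu(x;t)$ at $t=-1$, in the standard normalization of Macdonald's book). The functions $Q_{\mu^r}(x)S_{\mu^d}(x^2)$, $\mu\in P_n$, form a basis of the space of homogeneous symmetric functions of degree $n$ over $\mathbb{C}$, so the $a_{\lambda\mu}$ are well defined. *)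

(* Defs.v *)
From HB Require Import structures.
From mathcomp Require Import all_boot all_order all_fingroup all_algebra.
From mathcomp Require Export mpoly.
From Stdlib Require Import ClassicalEpsilon.

Set Implicit Arguments.
Unset Strict Implicit.
Unset Printing Implicit Defensive.

Import GRing.Theory Num.Theory.

Definition is_intpartn (n : nat) (s : seq nat) : bool :=
  [&& sorted geq s, 0 \notin s & sumn s == n].

Record intpartn (n : nat) : Type :=
  IntPartn { parts :> seq nat; _ : is_intpartn n parts }.

HB.instance Definition _ n := [isSub for @parts n].
HB.instance Definition _ n := [Countable of intpartn n by <:].

Lemma leq_size_sumn (s : seq nat) : 0 \notin s -> size s <= sumn s.
Proof.
elim: s => //= a s IHs; rewrite inE negb_or eq_sym -lt0n => /andP[a_gt0 /IHs].
by move=> le_s; rewrite -add1n leq_add.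
Qed.

Lemma mem_leq_sumn (s : seq nat) i : i \in s -> i <= sumn s.
Proof.
elim: s => //= a s IHs; rewrite inE => /predU1P[-> | /IHs]; first exact: leq_addr.
by move/leq_trans; apply; apply: leq_addl.
Qed.

Definition intpartn_code (n : nat) (lam : intpartn n) : n.-bseq 'I_n.+1 :=
  insub_bseq n [seq inord i | i <- lam].

Definition intpartn_decode (n : nat) (s : n.-bseq 'I_n.+1) :
    option (intpartn n) :=
  insub [seq nat_of_ord i | i <- s].

Lemma intpartn_codeK (n : nat) :
  pcancel (@intpartn_code n) (@intpartn_decode n).
Proof.
move=> lam; case/and3P: (valP lam) => /= _ lam0 /eqP sum_lam.
rewrite /intpartn_code /intpartn_decode /insub_bseq insubdK; last first.
  by rewrite -topredE /= size_map -[X in _ <= X]sum_lam leq_size_sumn.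
rewrite -map_comp map_id_in ?valK // => i /mem_leq_sumn.
by rewrite sum_lam => le_in /=; rewrite inordK.
Qed.

HB.instance Definition _ (n : nat) :=
  isFinite.Build (intpartn n) (pcan_enumP (@intpartn_codeK n)).

(* The partition in which i occurs m i times for 1 <= i <= b and which has no
   part larger than b. *)
Definition part_of_mult (b : nat) (m : nat -> nat) : seq nat :=
  flatten [seq nseq (m i) i | i <- rev (iota 1 b)].

Definition rpart (lam : seq nat) : seq nat :=
  part_of_mult (sumn lam) (fun i => odd (count_mem i lam)).

Definition dpart (lam : seq nat) : seq nat :=
  part_of_mult (sumn lam) (fun i => (count_mem i lam)./2).

(* logn 2 k and k`_2^' are the p and the q of k = 2 ^ p * q with q odd. *)
Definition glaisher (lam : seq nat) : seq nat :=
  part_of_mult (sumn lam)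
    (fun i => \sum_(k <- lam | k`_2^' == i) 2 ^ logn 2 k).

Definition block_parts (n0 n1 : nat) : {set intpartn (n0 + 2 * n1)} :=
  [set lam : intpartn (n0 + 2 * n1) |
     (sumn (rpart lam) == n0) && (sumn (dpart lam) == n1)].

Local Open Scope ring_scope.

(* Symmetric functions are compatible families of symmetric polynomials in
   N variables, N ranging over all natural numbers. As usual, Schur polynomials
   and Hall-Littlewood polynomials of partitions with more than N parts are 0. *)

Section Schur.
Variables (R : idomainType) (N : nat).

Definition alternant (e : 'I_N -> nat) : {mpoly R[N]} :=
  \det (\matrix_(i < N, j < N) ('X_i : {mpoly R[N]}) ^+ e j).

(* The quotient of the alternants of lam + delta and of
   delta = (N - 1, ..., 1, 0): there is exactly one such polynomial s. *)
Definition schur (lam : seq nat) : {mpoly R[N]} :=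
  if (size lam <= N)%N then
    epsilon (inhabits 0) (fun s : {mpoly R[N]} =>
      s * alternant (fun j => N - j.+1)%N
      = alternant (fun j => nth 0 lam j + (N - j.+1))%N)
  else 0.

End Schur.

(* S_lam(x, x); by symmetry of S_lam the order of the 2N variables does not
   matter. *)
Definition schur_dup (R : idomainType) (N : nat) (lam : seq nat) :
    {mpoly R[N]} :=
  schur R (N + N) lam
    \mPo [tuple of [tuple 'X_i | i < N] ++ [tuple 'X_i | i < N]].

Definition schur_sq (R : idomainType) (N : nat) (nu : seq nat) :
    {mpoly R[N]} :=
  schur R N nu \mPo [tuple ('X_i : {mpoly R[N]}) ^+ 2 | i < N].

Section HallLittlewood.
Variables (F : fieldType) (N : nat) (x : 'I_N -> F) (t : F).

(* Macdonald, III (2.2): the sum over the cosets in 'S_N of the stabiliser of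
   lam is written as the sum over 'S_N divided by the order of the stabiliser
   (so F is meant to have characteristic 0). *)
Definition HLP (lam : seq nat) : F :=
  if (size lam <= N)%N then
    (#|[set w : 'S_N | [forall i, nth 0%N lam (w i) == nth 0%N lam i]]|%:R)^-1
    * \sum_(w : 'S_N)
        ((\prod_(i < N) x (w i) ^+ nth 0%N lam i)
         * \prod_(i < N) \prod_(j < N | (nth 0%N lam j < nth 0%N lam i)%N)
             ((x (w i) - t * x (w j)) / (x (w i) - x (w j))))
  else 0.

Definition HLb (lam : seq nat) : F :=
  \prod_(1 <= i < (sumn lam).+1)
    \prod_(1 <= k < (count_mem i lam).+1) (1 - t ^+ k).

Definition HLQ (lam : seq nat) : F := HLb lam * HLP lam.

End HallLittlewood.

Definition schurQ (R : idomainType) (N : nat) (mu : seq nat) :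
    {fraction {mpoly R[N]}} :=
  HLQ (fun i : 'I_N => tofrac ('X_i : {mpoly R[N]})) (-1) mu.

(* A is the matrix A_n = (a_{lam,mu}). *)
Definition is_mixed_expansion (C : numClosedFieldType) (n : nat)
    (A : 'M[C]_#|{: intpartn n}|) : Prop :=
  forall (lam : intpartn n) (N : nat),
    tofrac (schur_dup C N lam) =
    \sum_(mu : intpartn n)
      tofrac ((A (enum_rank lam) (enum_rank mu))%:MP_[N])
      * schurQ C N (rpart mu) * tofrac (schur_sq C N (dpart mu)).

Definition submx_on (C : numClosedFieldType) (T : finType) (P : {set T})
    (M : 'M[C]_#|T|) : 'M[C]_#|P| :=
  \matrix_(i, j) M (enum_rank (enum_val i)) (enum_rank (enum_val j)).

(* Main.v *)
(* Write symmetric functions as polynomials in the power sums p_k, and let <,>_c be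
   the form in which the monomials in the p_k are orthogonal and multiplication by
   p_k is adjoint to (k / c) d/dp_k. Schur functions are orthonormal for <,>_1.
   Q-functions of strict partitions involve only odd p_k and are orthogonal of
   norm 2^l for <,>_2. Hence
   - S_lam(x, x), which is S_lam with p_k replaced by 2 p_k, is orthonormal for
     <,>_4, so that A^T A is the inverse of the Gram matrix of the functions
     b_mu = Q_(mu^r)(x) S_(mu^d)(x^2) for <,>_4;
   - the b_mu are orthogonal of norm 2^l(mu^r) for <,>_2.
   The forms <,>_2 and <,>_4 differ by the factor 2^(number of factors) on each
   monomial in the p_k, and the block P_(n0,n1) corresponds to the monomials whose
   odd part has degree n0; Glaisher's map lists these monomials as lam^r~ together
   with twice lam^d. Comparing both Gram determinants gives the formula.

   Both orthogonality relations come from one computation with vertex operators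
   B_r: the function of lam = (l_1, l_2, ...) is B_(l_1) B_(l_2) ... 1, and the
   adjoints satisfy B*_r B_s + B_(s+eps) B*_(r+eps) = c delta_(r,s) where
   (eps, c) = (1, 1) for Schur functions and (0, 2) for Q-functions. *)
From HB Require Import structures.
Require Import Defs.
From mathcomp Require Import all_boot all_order all_fingroup all_algebra.
From mathcomp Require Import zify ring.
From Stdlib Require Import ClassicalEpsilon.

Set Implicit Arguments.
Unset Strict Implicit.
Unset Printing Implicit Defensive.

Import GRing.Theory Num.Theory.

(** The hypothesis on [A] concerns polynomials in N variables, defined by quotients of alternants
    and by symmetrisation, while the forms and the vertex operators live on a free polynomial ring
    whose generators stand for power sums. Two bridges join them. Towards points: the classical
    formulas and the vertex operators obey one recursion, in which a single variable carries the
    largest part; its weights are the residues of [prod_i (1 - t x_i u) / (1 - x_i u)], with t = 0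
    for Schur functions and t = -1 for Q-functions. Back from points: the expansion in 2n variables
    lifts to the free ring because [p_1, ..., p_2n] are algebraically independent there. The b_mu
    are orthogonal for <,>_2 because substituting squares sends [p_k] to [p_2k], whose norm [2k / 2]
    for <,>_2 is the norm [k] of [p_k] for <,>_1, and because the Q-factor involves only the other,
    odd power sums. In monomial coordinates both Gram blocks have the form [M W M^T] with the same
    coefficient block [M] and a diagonal [W], so the unknown [(det M)^2] cancels in the
    comparison. *)

Local Open Scope ring_scope.

(** * Newton sequences *)

(* [p k] plays the role of the power sum of degree [k] ([p 0] is never used),
   and [h] is the sequence with generating series exp (sum_k p_k u^k / k). *)
Definition newton (R : comNzRingType) (p h : nat -> R) : Prop :=
  h 0 = 1 /\ forall n, h n.+1 *+ n.+1 = \sum_(i < n.+1) p i.+1 * h (n - i)%N.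

Definition conv (R : comNzRingType) (a b : nat -> R) (n : nat) : R :=
  \sum_(i < n.+1) a i * b (n - i)%N.

Section Newton.
Variable R : comNzRingType.
Implicit Types (p h a b : nat -> R).

Lemma conv_poly a b M n : (n < M)%N ->
  conv a b n = (\poly_(i < M) a i * \poly_(i < M) b i)`_n.
Proof.
move=> lt_nM; rewrite coefM; apply: eq_bigr => i _.
by rewrite !coef_poly !(leq_ltn_trans _ lt_nM) ?leq_subr // -ltnS ltn_ord.
Qed.

Lemma conv_delta a : conv (fun n => (n == 0%N)%:R) a =1 a.
Proof.
move=> n; rewrite /conv big_ord_recl mul1r subn0 big1 ?addr0 // => i _.
by rewrite mul0r.
Qed.

Lemma eq_newton p p' h h' :
  (forall k, p k.+1 = p' k.+1) -> h =1 h' -> newton p h -> newton p' h'.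
Proof.
move=> eq_p eq_h [h0 hS]; split=> [|n]; first by rewrite -eq_h.
by rewrite -eq_h hS; apply: eq_bigr => i _; rewrite eq_p eq_h.
Qed.

(** The recursion is the differential equation [dH/du = (sum_k p_(k+1) u^k) H] for the generating
    series, so the product rule adds the power sums. It is applied to polynomials truncated after
    degree [n.+1], whose derivatives are right up to degree [n]. *)
Lemma newton_conv p p' h h' :
  newton p h -> newton p' h' -> newton (fun k => p k + p' k) (conv h h').
Proof.
move=> [h0 hS] [h'0 h'S]; split=> [|n].
  by rewrite /conv big_ord1 h0 h'0 mulr1.
pose T a := \poly_(i < n.+2) a i.
have derT q g :
    (forall n, g n.+1 *+ n.+1 = \sum_(i < n.+1) q i.+1 * g (n - i)%N) ->
    forall i, (i < n.+1)%N ->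
    (T g)^`()`_i = (T (fun k => q k.+1) * T g)`_i.
  move=> gS i lt_in; rewrite coef_deriv coef_poly ltnS lt_in gS.
  by rewrite -(@conv_poly (fun k => q k.+1) g n.+2) // ltnW.
have mulT g g' i : (i < n.+2)%N -> (T g * T g')`_i = conv g g' i.
  by move=> lt_in; rewrite -conv_poly.
rewrite -mulT // -coef_deriv derivM coefD.
have -> : ((T h)^`() * T h')`_n
    = (T (fun k => p k.+1) * T h * T h')`_n.
  by rewrite !coefM; apply: eq_bigr => i _; rewrite (derT _ _ hS) // coefM.
have -> : (T h * (T h')^`())`_n
    = (T (fun k => p' k.+1) * (T h * T h'))`_n.
  rewrite mulrCA coefM [RHS]coefM; apply: eq_bigr => i _.
  by rewrite (derT _ _ h'S) ?ltnS ?leq_subr // coefM.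
rewrite -mulrA -coefD -mulrDl coefM; apply: eq_bigr => i _.
have lt_in2 : (i < n.+2)%N by apply: ltnW; rewrite ltnS.
rewrite coefD !coef_poly lt_in2 mulT //.
by rewrite ltnS (leq_trans (leq_subr _ _)).
Qed.

Lemma newton0 : newton (fun=> 0) (fun n => (n == 0%N)%:R : R).
Proof.
by split=> // n; rewrite mul0rn big1 // => i _; rewrite mul0r.
Qed.

Lemma newton_geometric (x : R) : newton (fun k => x ^+ k) (fun n => x ^+ n).
Proof.
split=> [|n]; first by rewrite expr0.
rewrite (eq_bigr (fun=> x ^+ n.+1)) => [|i _].
  by rewrite sumr_const card_ord.
by rewrite -exprD addSn subnKC // -ltnS.
Qed.

(** [log (1 - x u) = - sum_k x^k u^k / k]. *)
Lemma newton_linear (x : R) :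
  newton (fun k => - x ^+ k) (fun n => (1 - x *: 'X : {poly R})`_n).
Proof.
have coefE n : (1 - x *: 'X : {poly R})`_n
    = (n == 0)%:R - x * (n == 1)%:R.
  by rewrite coefB coef1 coefZ coefX.
split=> [|n]; first by rewrite coefE mulr0 subr0.
rewrite coefE sub0r; under eq_bigr do rewrite coefE.
case: n => [|n]; first by rewrite big_ord1 mulr0 subr0 !mulr1.
rewrite mulr0 oppr0 mul0rn !big_ord_recr /= big1 => [|i _].
  by rewrite subnn subSnn !(mulr0, mulr1) !(subr0, sub0r) add0r mulrN mulr1
             mulNr opprK -exprSr subrr.
have lt_i := ltn_ord i.
have [-> ->] : (n.+1 - i == 0)%N = false /\ (n.+1 - i == 1)%N = false by lia.
by rewrite mulr0 subr0 mulr0.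
Qed.

Lemma newton_prod (I : Type) (r : seq I) (P : pred I) (x : I -> R) :
  newton (fun k => - \sum_(i <- r | P i) x i ^+ k)
         (fun n => (\prod_(i <- r | P i) (1 - x i *: 'X))`_n).
Proof.
elim: r => [|i r IHr].
  apply: eq_newton newton0 => k; first by rewrite big_nil oppr0.
  by rewrite big_nil coef1.
have [Pi|nPi] := boolP (P i); last first.
  by apply: eq_newton IHr => k; rewrite big_cons (negbTE nPi).
apply: eq_newton (newton_conv (newton_linear (x i)) IHr) => k.
  by rewrite big_cons Pi opprD.
by rewrite big_cons Pi coefM.
Qed.

Lemma newton_morph (S : comNzRingType) (f : {rmorphism R -> S}) p h :
  newton p h -> newton (f \o p) (f \o h).
Proof.
move=> [h0 hS]; split=> [|n] /=; first by rewrite h0 rmorph1.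
by rewrite -rmorphMn hS rmorph_sum; apply: eq_bigr => i _; rewrite rmorphM.
Qed.

Lemma newton_scale (v : R) p h :
  newton p h -> newton (fun k => v ^+ k * p k) (fun k => v ^+ k * h k).
Proof.
move=> [h0 hS]; split=> [|n]; first by rewrite expr0 h0 mulr1.
rewrite -mulrnAr hS mulr_sumr; apply: eq_bigr => i _.
by rewrite mulrACA -exprD addSn subnKC // -ltnS.
Qed.

(** The recursion gives [h n.+1] only after division by [n.+1], which torsion-freeness permits. The
    bound [M] serves the later cases in which the power sums are controlled only up to some
    degree. *)
Lemma newton_uniq_leq p p' h h' M :
  (forall (x : R) n, x *+ n.+1 = 0 -> x = 0) ->
  (forall k, (k < M)%N -> p k.+1 = p' k.+1) ->
  newton p h -> newton p' h' -> forall n, (n <= M)%N -> h n = h' n.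
Proof.
move=> tfree eq_p [h0 hS] [h'0 h'S] n; elim/ltn_ind: n => -[|n] IHn le_nM.
  by rewrite h0 h'0.
apply/subr0_eq/(tfree _ n); rewrite mulrnBl hS h'S -sumrB big1 // => i _.
have lt_i := ltn_ord i.
by rewrite IHn ?eq_p ?subrr //; lia.
Qed.

Lemma newton_uniq p h h' :
  (forall (x : R) n, x *+ n.+1 = 0 -> x = 0) ->
  newton p h -> newton p h' -> h =1 h'.
Proof.
by move=> tfree newt newt' n; apply: (@newton_uniq_leq p p _ _ n).
Qed.

End Newton.

Section NewtonExistence.
Variables (C : numFieldType) (K : nat).
Implicit Type p : nat -> {mpoly C[K]}.

(** The list of all earlier values is carried along, since the recursion refers to every one of
    them. *)
Fixpoint newton_rec p (n : nat) : seq {mpoly C[K]} :=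
  if n is m.+1 then
    let s := newton_rec p m in
    rcons s (m.+1%:R^-1 *: \sum_(i < m.+1) p i.+1 * s`_(m - i))
  else [:: 1].

Definition newton_seq p (n : nat) : {mpoly C[K]} := (newton_rec p n)`_n.

Lemma newton_seqP p : newton p (newton_seq p).
Proof.
have size_rec n : size (newton_rec p n) = n.+1.
  by elim: n => //= n IHn; rewrite size_rcons IHn.
have nth_rec m n : (m <= n)%N -> (newton_rec p n)`_m = newton_seq p m.
  elim: n => [|n IHn]; first by rewrite leqn0 => /eqP->.
  rewrite leq_eqVlt => /predU1P[-> //|lt_mn].
  by rewrite /= nth_rcons size_rec lt_mn IHn.
split=> // n; rewrite {1}/newton_seq /= nth_rcons size_rec ltnn eqxx.
rewrite -scaler_nat scalerA divff ?pnatr_eq0 // scale1r.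
by apply: eq_bigr => i _; rewrite nth_rec // leq_subr.
Qed.

End NewtonExistence.

(** * Polynomials in power sums *)

Lemma mpoly_mulX_ind (R : comNzRingType) (K : nat) (P : {mpoly R[K]} -> Prop) :
  P 1 -> (forall f g, P f -> P g -> P (f + g)) ->
  (forall a f, P f -> P (a *: f)) -> (forall k f, P f -> P ('X_k * f)) ->
  forall f, P f.
Proof.
move=> P1 PD PZ PX f.
have P0 : P 0 by rewrite -(scale0r 1); apply: PZ.
rewrite [f]mpolyE; apply: (big_ind P) => // m _; apply: PZ.
move: {2}(mdeg m) (erefl (mdeg m)) => e; elim: e m => [|e IHe] m deg_m.
  by move/eqP: deg_m; rewrite mdeg_eq0 => /eqP->; rewrite mpolyX0.
have [k k_gt0] : exists k, (0 < m k)%N.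
  apply/existsP; apply: contraT; rewrite negb_exists => /forallP m0.
  suff: mdeg m = 0%N by rewrite deg_m.
  by rewrite mdegE big1 // => i _; apply/eqP; rewrite eqn0Ngt m0.
have le_km : (U_(k) <= m)%MM by rewrite lep1mP -lt0n.
rewrite -(submK le_km) addmC mpolyXD; apply/PX/IHe.
by move: deg_m; rewrite -{1}(submK le_km) mdegD mdeg1 addn1 => -[].
Qed.

Lemma mderivXU (R : nzRingType) K (i j : 'I_K) :
  ('X_i : {mpoly R[K]})^`M(j) = (i == j)%:R.
Proof.
rewrite mderivX mnm1E; case: eqVneq => [->|_]; last by rewrite scale0r.
rewrite (_ : (U_(j) - U_(j))%MM = 0%MM) ?mpolyX0 ?scale1r //.
by apply/mnmP => l; rewrite mnmBE subnn mnm0E.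
Qed.

Lemma mpoly_torsion_free (C : numDomainType) K (f : {mpoly C[K]}) n :
  f *+ n.+1 = 0 -> f = 0.
Proof.
move=> f0; apply/mpolyP => m; rewrite mcoeff0; apply/eqP.
by have := mulrn_eq0 f@_m n.+1; rewrite -mcoeffMn f0 mcoeff0 eqxx /= => <-.
Qed.

Lemma poly_mpoly_torsion_free (C : numDomainType) K
    (f : {poly {mpoly C[K]}}) n : f *+ n.+1 = 0 -> f = 0.
Proof.
move=> f0; apply/polyP => i; rewrite coef0.
by apply: (@mpoly_torsion_free _ _ _ n); rewrite -coefMn f0 coef0.
Qed.

Section Weight.
Variables (K : nat) (d : 'I_K -> nat).

Definition weight (m : 'X_{1..K}) : nat := (\sum_k m k * d k)%N.

Lemma weight0 : weight 0%MM = 0%N.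
Proof. by rewrite /weight big1 // => k _; rewrite mnm0E. Qed.

Lemma weightD : {morph weight : m1 m2 / (m1 + m2)%MM >-> (m1 + m2)%N}.
Proof.
move=> m1 m2; rewrite /weight -big_split /=.
by apply: eq_bigr => k _; rewrite mnmDE mulnDl.
Qed.

HB.instance Definition _ := isMeasure.Build K weight weight0 weightD.

Lemma weightU k : weight U_(k)%MM = d k.
Proof.
rewrite /weight (bigD1 k) //= mnm1E eqxx mul1n big1 ?addn0 // => j.
by rewrite mnm1E eq_sym => /negbTE->.
Qed.

End Weight.

(* The ring of polynomials in variables of degrees [d k], the variable ['X_k]
   standing for the power sum of degree [d k]; [ip] is the bilinear form for
   which multiplication by ['X_k] is adjoint to [(d k / c) d/d'X_k]. *)
Section Fock.
Variables (C : numFieldType) (K : nat) (d : 'I_K -> nat) (c : C).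
Hypothesis d_gt0 : forall k, (0 < d k)%N.
Hypothesis c_neq0 : c != 0.
Local Notation R := {mpoly C[K]}.
Local Notation hom w := (ishomog1 w (weight d)).
Implicit Types (f g : R) (m : 'X_{1..K}).

(** The norm of a monomial in the power sums, classically [z_lambda / c ^ l(lambda)]. *)
Definition ipw m : C := \prod_k (((d k)%:R / c) ^+ m k * (m k)`!%:R).

Lemma ipw_neq0 m : ipw m != 0.
Proof.
apply/prodf_neq0 => k _; rewrite mulf_neq0 ?expf_neq0 //.
  by rewrite mulf_neq0 ?invr_eq0 // pnatr_eq0 -lt0n.
by rewrite pnatr_eq0 -lt0n fact_gt0.
Qed.

Definition ip f g : C := \sum_(m <- msupp f) f@_m * g@_m * ipw m.

Lemma ip_seq (s : seq 'X_{1..K}) f g : uniq s -> {subset msupp f <= s} ->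
  ip f g = \sum_(m <- s) f@_m * g@_m * ipw m.
Proof.
move=> Us sfs; rewrite [RHS](bigID (mem (msupp f))) /= [X in _ + X]big1 ?addr0.
  rewrite -big_filter; apply: perm_big; apply: uniq_perm.
  - exact: msupp_uniq.
  - exact: filter_uniq.
  by move=> m; rewrite mem_filter; case: (boolP (m \in _)) => // /sfs.
by move=> m; rewrite -mcoeff_eq0 => /eqP->; rewrite !mul0r.
Qed.

Lemma ipC f g : ip f g = ip g f.
Proof.
pose s := undup (msupp f ++ msupp g).
rewrite !(@ip_seq s) ?undup_uniq //.
- by apply: eq_bigr => m _; rewrite [f@_m * _]mulrC.
- by move=> m; rewrite mem_undup mem_cat orbC => ->.
- by move=> m; rewrite mem_undup mem_cat => ->.
Qed.

Lemma ip_is_linear f : linear (ip f : R -> C^o).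
Proof.
move=> a g h; rewrite /ip scaler_sumr -big_split; apply: eq_bigr => m _.
by rewrite mcoeffD mcoeffZ /= /GRing.scale /=; ring.
Qed.
HB.instance Definition _ f :=
  GRing.isLinear.Build C R C^o _ (ip f) (ip_is_linear f).

Lemma ip_mulrZ a f g : ip f (a *: g) = a * ip f g.
Proof. exact: linearZ. Qed.

Lemma ip_mullZ a f g : ip (a *: f) g = a * ip f g.
Proof. by rewrite ipC ip_mulrZ ipC. Qed.

Lemma ipDl f g h : ip (f + g) h = ip f h + ip g h.
Proof. by rewrite ipC linearD /= !(ipC h). Qed.

Lemma ip_suml (I : Type) (r : seq I) (P : pred I) (F : I -> R) g :
  ip (\sum_(i <- r | P i) F i) g = \sum_(i <- r | P i) ip (F i) g.
Proof. by rewrite ipC linear_sum; apply: eq_bigr => i _; rewrite ipC. Qed.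

Lemma ip_monomial m g : ip 'X_[m] g = ipw m * g@_m.
Proof. by rewrite /ip msuppX big_seq1 mcoeffX eqxx mul1r mulrC. Qed.

(** Transposes identities between multiplication operators into identities between their adjoints,
    as in [shiftC] and [shift_inv]. *)
Lemma ip_nondegenerate f g : (forall h, ip h f = ip h g) -> f = g.
Proof.
move=> eq_fg; apply/mpolyP => m; apply: (mulfI (ipw_neq0 m)).
by rewrite -!ip_monomial.
Qed.

Lemma ipw_addU m k : ipw (U_(k) + m) = (d k)%:R / c * (m k).+1%:R * ipw m.
Proof.
rewrite /ipw (bigD1 k) //= [in RHS](bigD1 k) //= mnmDE mnm1E.
rewrite eqxx add1n exprS factS natrM.
have -> : \prod_(i | i != k) (((d i)%:R / c) ^+ (U_(k) + m)%MM i
                               * ((U_(k) + m)%MM i)`!%:R)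
    = \prod_(i | i != k) (((d i)%:R / c) ^+ m i * (m i)`!%:R).
  by apply: eq_bigr => i ne_ik; rewrite mnmDE mnm1E eq_sym (negbTE ne_ik).
ring.
Qed.

Lemma ip_mulX k f g : ip ('X_k * f) g = (d k)%:R / c * ip f g^`M(k).
Proof.
rewrite [f]mpolyE mulr_sumr !ip_suml mulr_sumr; apply: eq_bigr => m _.
rewrite -scalerAr -mpolyXD !ip_mullZ !ip_monomial mcoeff_deriv ipw_addU.
by rewrite [(m + _)%MM]addmC -mulr_natr; ring.
Qed.

Lemma ip_homog_neq v w f g : f \is hom v -> g \is hom w -> v != w ->
  ip f g = 0.
Proof.
move=> /dhomogP hom_f hom_g ne_vw; rewrite /ip big_seq big1 // => m /hom_f fm.
by rewrite (dhomog_nemf_coeff hom_g) ?mulr0 ?mul0r //= fm.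
Qed.

Definition psum (k : nat) : R := \sum_(j | d j == k) 'X_j.

(** Coefficients of [exp (s c sum_k p_k u^k / k)]. For [s = 1] they are the complete functions [h_n]
    when [c = 1], and the [q_n] when [c = 2] and only odd power sums are present; [s = -1] gives the
    inverse series. *)
Definition qseq (s : C) (n : nat) : R :=
  newton_seq (fun k => (s * c) *: psum k) n.

Lemma newton_qseq s : newton (fun k => (s * c) *: psum k) (qseq s).
Proof. exact: newton_seqP. Qed.

Lemma qseq0 s : qseq s 0 = 1.
Proof. by case: (newton_qseq s). Qed.

Lemma qseqS s n : qseq s n.+1
  = n.+1%:R^-1 *: \sum_(i < n.+1) ((s * c) *: psum i.+1) * qseq s (n - i).
Proof.
case: (newton_qseq s) => _ <-.
by rewrite -scaler_nat scalerA mulVf ?scale1r // pnatr_eq0.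
Qed.

Lemma homog_sum (I : Type) (r : seq I) (P : pred I) (F : I -> R) w :
  (forall i, P i -> F i \is hom w) -> \sum_(i <- r | P i) F i \is hom w.
Proof.
move=> homF; apply: (big_ind (fun f => f \is hom w)) => //.
  exact: dhomog0.
exact: dhomogD.
Qed.

Lemma homog_psum k : psum k \is hom k.
Proof. by apply: homog_sum => j /eqP dj; rewrite dhomogX /= weightU dj. Qed.

Lemma homog_qseq s n : qseq s n \is hom n.
Proof.
elim/ltn_ind: n => -[|n] IHn; first by rewrite qseq0 dhomog1.
rewrite qseqS; apply/dhomogZ/homog_sum => i _.
have lt_i := ltn_ord i; have e : (i.+1 + (n - i) = n.+1)%N by lia.
have := dhomogM (dhomogZ (s * c) (homog_psum i.+1)) (IHn (n - i)%N _).
by rewrite e; apply; lia.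
Qed.

Lemma deriv_psum j k : (psum k)^`M(j) = (d j == k)%:R.
Proof.
rewrite raddf_sum /=.
under eq_bigr do rewrite mderivXU.
case: (eqVneq (d j) k) => [<-|ne_jk].
  by rewrite (bigD1 j) //= eqxx big1 ?addr0 // => i /andP[_ /negbTE->].
rewrite big1 // => i /eqP di; case: eqP => // eq_ij.
by rewrite -eq_ij di eqxx in ne_jk.
Qed.

(** Differentiating the exponential by a power sum of degree [k = d j] multiplies it by
    [s c u^k / k]. *)
Lemma deriv_qseq s j n :
  (qseq s n)^`M(j)
    = if (d j <= n)%N then (s * c / (d j)%:R) *: qseq s (n - d j) else 0.
Proof.
have dj_neq0 : (d j)%:R != 0 :> C by rewrite pnatr_eq0 -lt0n.
elim/ltn_ind: n => -[|n] IHn.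
  by rewrite leqn0 eqn0Ngt d_gt0 qseq0 -mpolyC1 mderivC.
rewrite qseqS mderivZ (linear_sum (mderiv j)) /=.
under eq_bigr => i _.
  rewrite mderivM mderivZ deriv_psum IHn ?ltnS ?leq_subr //; over.
rewrite big_split /=.
have [le_jn|lt_nj] := leqP (d j) n.+1; last first.
  rewrite !big1 ?addr0 ?scaler0 // => i _; have lt_i := ltn_ord i.
    by have -> : (d j <= n - i)%N = false; [lia | rewrite mulr0].
  by have -> : (d j == i.+1)%N = false; [lia | rewrite scaler0 mul0r].
have dj_pos := d_gt0 j.
have -> : \sum_(i < n.+1) (s * c) *: (d j == i.+1)%:R * qseq s (n - i)
    = (s * c) *: qseq s (n.+1 - d j).
  have lt_jn : ((d j).-1 < n.+1)%N by lia.
  rewrite (bigD1 (Ordinal lt_jn)) //= prednK // eqxx big1 ?addr0.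
    rewrite -scalerAl mul1r; congr (_ *: qseq s _); lia.
  move=> i; rewrite -(inj_eq val_inj) /= => ne_i.
  by have -> : (d j == i.+1)%N = false; [lia | rewrite scaler0 mul0r].
have -> : \sum_(i < n.+1) (s * c) *: psum i.+1 *
      (if (d j <= n - i)%N then (s * c / (d j)%:R) *: qseq s (n - i - d j)
       else 0)
    = (s * c / (d j)%:R) *: (qseq s (n.+1 - d j) *+ (n.+1 - d j)).
  transitivity ((s * c / (d j)%:R) *: \sum_(i < n.+1 | (i < n.+1 - d j)%N)
       (s * c) *: psum i.+1 * qseq s (n - i - d j)).
    rewrite scaler_sumr [RHS]big_mkcond /=; apply: eq_bigr => i _.
    have lt_i := ltn_ord i.
    have -> : (d j <= n - i)%N = (i < n.+1 - d j)%N by lia.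
    by case: ifP => _; rewrite ?mulr0 // -scalerAr.
  congr (_ *: _); rewrite -(big_ord_widen n.+1 (fun i =>
    (s * c) *: psum i.+1 * qseq s (n - i - d j))) ?leq_subr //.
  case E: (n.+1 - d j)%N => [|e]; first by rewrite big_ord0.
  case: (newton_qseq s) => _ ->; apply: eq_bigr => i _.
  by congr (_ * qseq s _); lia.
(* The two sums contribute the same term [d j] and [n.+1 - d j] times, which cancels
   [n.+1%:R^-1]. *)
rewrite -scaler_nat scalerA -scalerDl scalerA; congr (_ *: _).
have n1_neq0 : n.+1%:R != 0 :> C by rewrite pnatr_eq0.
rewrite natrB //; move: (n.+1%:R) n1_neq0 => N N_neq0.
by field; rewrite dj_neq0 N_neq0.
Qed.

(** For [s = 1] a letter [u] is adjoined to the alphabet, so a power sum of degree [k] gains [u^k];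
    for [s = -1] a letter is removed. The coefficient of [u^l] is the adjoint of multiplication by
    [qseq s l]. *)
Definition shift (s : C) : R -> {poly R} :=
  mmap (polyC \o @mpolyC K C) (fun k => ('X_k)%:P + s%:MP *: 'X^(d k)).
HB.instance Definition _ s := GRing.RMorphism.on (shift s).

Lemma shiftZ s a f : shift s (a *: f) = a%:MP *: shift s f.
Proof. by rewrite /shift mmapZ /= mul_polyC. Qed.

Lemma shiftX s k : shift s 'X_k = ('X_k)%:P + s%:MP *: 'X^(d k).
Proof. by rewrite /shift mmapX mmap1U. Qed.

Lemma coef_shiftZ s a f l : (shift s (a *: f))`_l = a *: (shift s f)`_l.
Proof. by rewrite shiftZ coefZ mul_mpolyC. Qed.

Lemma coef_shift_mulX s k f l : (shift s ('X_k * f))`_l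
  = 'X_k * (shift s f)`_l
    + if (d k <= l)%N then s *: (shift s f)`_(l - d k) else 0.
Proof.
rewrite rmorphM /= shiftX mulrDl coefD coefCM -scalerAl coefZ coefXnM.
rewrite mul_mpolyC ltnNge; case: (d k <= l)%N => //=.
by rewrite scaler0.
Qed.

(* By induction on [g]: both sides transform in the same way when [g] is
   multiplied by a variable. *)
Lemma ip_qseq_shift s l f g : ip (qseq s l * f) g = ip f (shift s g)`_l.
Proof.
elim/mpoly_mulX_ind: g l f => [|g h IHg IHh|a g IHg|k g IHg] l f.
- rewrite rmorph1 coef1 ipC -[X in ip X _ = _]mpolyX0 ip_monomial.
  rewrite rmorphM /=.
  have [->|l_gt0] := posnP l.
    by rewrite qseq0 mulr1n rmorph1 mul1r [RHS]ipC -[1 in RHS]mpolyX0 ip_monomial.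
  rewrite mulr0n linear0.
  rewrite (dhomog_nemf_coeff (homog_qseq s l)) ?mul0r ?mulr0 //=.
  by rewrite weight0 eq_sym -lt0n.
- by rewrite rmorphD coefD !linearD /= IHg IHh.
- by rewrite coef_shiftZ !ip_mulrZ IHg.
rewrite ipC ip_mulX ipC mderivM ipDl mulrDr deriv_qseq coef_shift_mulX linearD /=.
have c_dk : (d k)%:R / c * (s * c / (d k)%:R) = s.
  by field; rewrite c_neq0 pnatr_eq0 -lt0n d_gt0.
rewrite addrC; congr (_ + _).
  by rewrite IHg mulrC; rewrite [RHS]ipC ip_mulX ipC mulrC.
case: ifP => _; last by rewrite mul0r [ip 0 _]ipC !linear0 mulr0.
by rewrite -scalerAl ip_mullZ mulrA c_dk IHg ip_mulrZ.
Qed.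

(** Up to the norm of ['X_[m]], this coefficient is the product of [qseq s l * 'X_[m]] with [f],
    which vanishes when the degrees differ. *)
Lemma coef_shift_neq0 s l w f m : f \is hom w -> (shift s f)`_l@_m != 0 ->
  (l + weight d m = w)%N.
Proof.
move=> hom_f; rewrite -(inj_eq (mulfI (ipw_neq0 m))) mulr0 -ip_monomial.
rewrite -ip_qseq_shift => neq0; apply/eqP; apply: contraNT neq0 => ne_w.
rewrite (@ip_homog_neq (l + weight d m)%N w) // dhomogM ?homog_qseq //.
by rewrite dhomogX.
Qed.

Lemma homog_shift s l w f : f \is hom w -> (shift s f)`_l \is hom (w - l)%N.
Proof.
move=> hom_f; apply/dhomogP => m; rewrite mcoeff_msupp => /coef_shift_neq0.
by move=> /(_ _ hom_f) <-; rewrite addKn.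
Qed.

Lemma shift_large s l w f : f \is hom w -> (w < l)%N -> (shift s f)`_l = 0.
Proof.
move=> hom_f lt_wl; apply/mpolyP => m; rewrite mcoeff0; apply/eqP.
by apply: contraTT lt_wl => /(coef_shift_neq0 hom_f) <-; rewrite -leqNgt leq_addr.
Qed.

Lemma size_shift s w f : f \is hom w -> (size (shift s f) <= w.+1)%N.
Proof. by move=> hom_f; apply/leq_sizeP => l; apply: shift_large. Qed.

Lemma qseq_conv s : conv (qseq s) (qseq (- s)) =1 fun n => (n == 0%N)%:R.
Proof.
have newt := newton_conv (newton_qseq s) (newton_qseq (- s)).
apply: newton_uniq newt _; first exact: mpoly_torsion_free.
apply: eq_newton (newton0 _) => // k.
by rewrite -scalerDl mulNr subrr scale0r.
Qed.

Lemma shiftC s s' a b f :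
  (shift s (shift s' f)`_b)`_a = (shift s' (shift s f)`_a)`_b.
Proof.
by apply: ip_nondegenerate => h; rewrite -!ip_qseq_shift mulrCA.
Qed.

Lemma shift_inv s n f :
  \sum_(i < n.+1) (shift s (shift (- s) f)`_(n - i))`_i = f *+ (n == 0%N).
Proof.
apply: ip_nondegenerate => h; rewrite linear_sum /=.
under eq_bigr do rewrite -!ip_qseq_shift mulrA.
rewrite -ip_suml -mulr_suml.
transitivity (ip (conv (qseq (- s)) (qseq s) n * h) f).
  congr (ip (_ * _) _); rewrite /conv [RHS](reindex_inj rev_ord_inj) /=.
  apply: eq_bigr => i _; rewrite subSS; congr (_ * qseq s _).
  by rewrite subKn // -ltnS.
rewrite -{2}[s]opprK qseq_conv; case: (n == 0%N); first by rewrite mul1r.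
by rewrite mul0r linear0 -(scale0r 1) ip_mullZ mul0r.
Qed.

(** Setting every generator to 1 means taking the alphabet with the single letter 1. The series of
    [psi] is the scalar factor that appears when a shift moves past a [qseq] series. *)
Definition psi : nat -> C := fun n => (qseq 1 n).@[fun=> 1].

Lemma newton_psi : newton (fun k => c *+ #|[pred j | d j == k]|) psi.
Proof.
have := newton_morph (meval (fun=> 1 : C)) (newton_qseq 1).
apply: eq_newton => // k /=; rewrite mevalZ mul1r raddf_sum /=.
under eq_bigr do rewrite mevalXU.
by rewrite sumr_const mulr_natr.
Qed.

(** Adding [s u^k] to [p_k] multiplies [exp (s c sum_k p_k w^k / k)] by a series in [u w] with
    exponent factor [s * s * c]; for both signs [s] this is [psi]. *)
Lemma shift_qseq s a n : s * s = 1 -> (shift s (qseq s n))`_a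
  = if (a <= n)%N then psi a *: qseq s (n - a) else 0.
Proof.
move=> s2; have newt1 := newton_morph (polyC : {rmorphism _ -> _}) (newton_qseq s).
have newt2 := newton_morph (polyC \o @mpolyC K C : {rmorphism _ -> _}) newton_psi.
have {newt2} newt := newton_conv newt1 (newton_scale 'X newt2).
have -> : shift s (qseq s n) = conv (polyC \o qseq s)
   (fun k => 'X^k * ((polyC \o @mpolyC K C) \o psi) k) n.
  apply: newton_uniq (newton_morph (shift s) (newton_qseq s)) _ n.
    exact: poly_mpoly_torsion_free.
  apply: eq_newton newt => // k /=.
  rewrite shiftZ [shift s _]raddf_sum /=.
  under [in RHS]eq_bigr => j /eqP dj do rewrite shiftX dj.
  rewrite big_split /= scalerDr -raddf_sum /=; congr (_ + _).
    by rewrite -mul_polyC -polyCM mul_mpolyC.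
  rewrite sumr_const -!scalerMnr scalerA -mpolyCM mulrAC s2 mul1r.
  by rewrite mulrC !raddfMn /= mulrnAl mul_polyC.
rewrite coef_sum.
under eq_bigr do rewrite /= coefCM -commr_polyXn coefCM coefXn.
case: leqP => [le_an|lt_na].
  rewrite (bigD1 (rev_ord (Ordinal (le_an : (a < n.+1)%N)))) //=.
  rewrite subSS subKn // eqxx mulr1 big1 ?addr0; first by rewrite mulrC mul_mpolyC.
  move=> i; rewrite -(inj_eq val_inj) /= subSS => ne_i; have lt_i := ltn_ord i.
  by have -> : (a == n - i)%N = false; [lia | rewrite !mulr0].
rewrite big1 // => i _.
by have -> : (a == n - i)%N = false; [lia | rewrite !mulr0].
Qed.

End Fock.

(** * Vertex operators *)

Section BigOrd.
Variable V : nmodType.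

Lemma big_ord_shift (F : nat -> V) L a : (forall j, (L <= j + a)%N -> F j = 0) ->
  \sum_(i < L | (a <= i)%N) F (i - a)%N = \sum_(j < L) F j.
Proof.
move=> F0; rewrite -(big_geq_mkord _ _ xpredT (fun i => F (i - a)%N)).
rewrite -{1}[a]add0n big_addn.
under eq_bigr do rewrite addnK.
rewrite big_mkord (big_ord_widen L) ?leq_subr //.
rewrite [RHS](bigID (fun j : 'I_L => (j < L - a)%N)) /=.
by rewrite [X in _ + X]big1 ?addr0 // => j; rewrite -leqNgt => ?; apply: F0; lia.
Qed.

Lemma big_ord_trunc (F : nat -> V) L A : (forall i, (L <= i)%N -> F i = 0) ->
  \sum_(i < A) F i = \sum_(i < L | (i < A)%N) F i.
Proof.
move=> F0; have [le_AL|lt_LA] := leqP A L; first exact: big_ord_widen.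
rewrite [RHS](eq_bigl xpredT) => [|i]; last by have := ltn_ord i; lia.
rewrite [RHS](big_ord_widen A) ?(ltnW lt_LA) //.
rewrite [LHS](bigID (fun j : 'I_A => (j < L)%N)) /=.
by rewrite [X in _ + X]big1 ?addr0 // => j; rewrite -leqNgt => ?; apply: F0; lia.
Qed.

Lemma exchange_big3 (F : nat -> nat -> nat -> V) L :
  \sum_(j < L) \sum_(m < L) \sum_(l < L) F j m l
    = \sum_(m < L) \sum_(l < L) \sum_(j < L) F j m l.
Proof. by rewrite exchange_big; apply: eq_bigr => m _; rewrite exchange_big. Qed.

End BigOrd.

Section VertexOperators.
Variables (C : numFieldType) (K : nat) (d : 'I_K -> nat) (c : C).
Hypothesis d_gt0 : forall k, (0 < d k)%N.
Hypothesis c_neq0 : c != 0.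
Implicit Types (f g : {mpoly C[K]}).
Local Notation hom w := (ishomog1 w (weight d)).

(** Bernstein's creation operator: the coefficient of [w^r] after removing a letter [1/w] and
    multiplying by the series of [qseq 1] in [w]. *)
Definition vertex (r : nat) f : {mpoly C[K]} :=
  \sum_(l < size (shift d (-1) f)) qseq d c 1 (r + l) * (shift d (-1) f)`_l.

Definition vertex_adj (r : nat) f : {mpoly C[K]} :=
  \sum_(m < size (shift d 1 f)) qseq d c (-1) m * (shift d 1 f)`_(r + m).

Lemma vertexE L r f : (size (shift d (-1) f) <= L)%N ->
  vertex r f = \sum_(l < L) qseq d c 1 (r + l) * (shift d (-1) f)`_l.
Proof.
move=> le_L; rewrite /vertex (big_ord_widen L (fun l =>
  qseq d c 1 (r + l) * (shift d (-1) f)`_l)) //.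
rewrite [RHS](bigID (fun l : 'I_L => (l < size (shift d (-1) f))%N)) /=.
rewrite [X in _ + X]big1 ?addr0 // => l; rewrite -leqNgt => le_l.
by rewrite nth_default ?mulr0.
Qed.

Lemma vertex_adjE L r f : (size (shift d 1 f) <= L)%N ->
  vertex_adj r f = \sum_(m < L) qseq d c (-1) m * (shift d 1 f)`_(r + m).
Proof.
move=> le_L; rewrite /vertex_adj (big_ord_widen L (fun m =>
  qseq d c (-1) m * (shift d 1 f)`_(r + m))) //.
rewrite [RHS](bigID (fun l : 'I_L => (l < size (shift d 1 f))%N)) /=.
rewrite [X in _ + X]big1 ?addr0 // => l; rewrite -leqNgt => le_l.
by rewrite nth_default ?mulr0 //; apply: leq_trans le_l (leq_addl _ _).
Qed.

Lemma vertex0 r : vertex r 0 = 0.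
Proof. by rewrite /vertex rmorph0 size_poly0 big_ord0. Qed.

Lemma homog_vertex r w f : f \is hom w -> vertex r f \is hom (r + w)%N.
Proof.
move=> hom_f; rewrite (@vertexE w.+1) ?(size_shift d_gt0 c_neq0) //.
apply: homog_sum => l _; have := ltn_ord l; rewrite ltnS => le_lw.
have -> : (r + w = (r + l) + (w - l))%N by lia.
by apply: dhomogM; [exact: homog_qseq | exact: (homog_shift d_gt0 c_neq0 _ _ hom_f)].
Qed.

Lemma ip_vertex v w r f g : f \is hom v -> g \is hom w ->
  ip d c (vertex r f) g = ip d c f (vertex_adj r g).
Proof.
move=> hom_f hom_g; pose L := (v + w).+1.
have size_f s : (size (shift d s f) <= L)%N.
  by apply: leq_trans (size_shift d_gt0 c_neq0 s hom_f) _; rewrite ltnS leq_addr.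
have size_g s : (size (shift d s g) <= L)%N.
  by apply: leq_trans (size_shift d_gt0 c_neq0 s hom_g) _; rewrite ltnS leq_addl.
rewrite (vertexE r (size_f _)) (vertex_adjE r (size_g _)).
rewrite ip_suml linear_sum; apply: eq_bigr => l _ /=.
rewrite ip_qseq_shift // ipC -ip_qseq_shift //; exact: ipC.
Qed.

End VertexOperators.

Section VertexRelation.
Variables (C : numFieldType) (K : nat) (d : 'I_K -> nat) (eps : bool) (D : nat).
Local Notation c := ((2 - eps)%:R : C).
Local Notation t := (1 - c).
Hypothesis d_gt0 : forall k, (0 < d k)%N.
(** One condition for both cases, in degrees up to [D]. For [eps = true], [c = 1] and [t = 0]:
    exactly one variable in each degree. For [eps = false], [c = 2] and [t = -1]: one variable in
    each odd degree and none in even degrees. *)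
Hypothesis d_count : forall k, (k < D)%N ->
  c *+ #|[pred j | d j == k.+1]| = 1 - t ^+ k.+1.
Implicit Types (f g : {mpoly C[K]}).
Local Notation hom w := (ishomog1 w (weight d)).
Local Notation q := (qseq d c).
Local Notation vertex := (vertex d c).
Local Notation vertex_adj := (vertex_adj d c).
Local Notation psi := (psi d c).

Lemma two_sub_neq0 : c != 0.
Proof. by rewrite pnatr_eq0; case: eps. Qed.
Local Notation c_neq0 := two_sub_neq0.

(** By [d_count] the series of [psi] agrees with [(1 - t z) / (1 - z)] up to degree [D], and
    [1 - t = c]. *)
Lemma psi_value j : (j <= D)%N -> psi j = if j == 0%N then 1 else c.
Proof.
move=> le_jD; have newt := newton_conv (newton_geometric 1) (newton_linear t).
rewrite (newton_uniq_leq (M := D) _ _ (newton_psi d c) newt) //; first last.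
- by move=> k lt_kD; rewrite d_count // expr1n.
- by move=> x n /eqP; rewrite mulrn_eq0 => /eqP.
have coefE n : (1 - t *: 'X : {poly C})`_n = (n == 0)%:R - t * (n == 1)%:R.
  by rewrite coefB coef1 coefZ coefX.
rewrite /conv; under eq_bigr do rewrite expr1n mul1r coefE.
case: j {le_jD} => [|j] /=; first by rewrite big_ord1 mulr0 subr0.
rewrite !big_ord_recr /= big1 => [|i _].
  by rewrite subnn subSnn add0r !mulr0 subr0 sub0r mulr1 opprB addrNK.
have lt_i := ltn_ord i.
have [-> ->] : (j.+1 - i == 0)%N = false /\ (j.+1 - i == 1)%N = false by lia.
by rewrite mulr0 subr0.
Qed.

(* For the generating series B(w), B*(u) of [vertex], [vertex_adj] and psi(z) of
   [psi], shifting the power sums past q(w) or q(u)^-1 gives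
   B*(u) B(w) = psi(uw) N(u, w) and B(w) B*(u) = psi(1/(uw)) N(u, w) for the same
   normally ordered N, and psi(z) + z^-eps psi(1/z) = c sum_(k in Z) z^k since
   psi(z) = 1 + c z + c z^2 + ...; finally N(u, 1/u) = 1. *)
Lemma vertex_relation r s w f : f \is hom w -> (s + w <= D)%N -> (s <= r)%N ->
  vertex_adj r (vertex s f) + vertex (s + eps) (vertex_adj (r + eps) f)
    = if r == s then c *: f else 0.
Proof.
(* [TD i l] is the annihilating half of the normally ordered product. It vanishes for [i + l > w],
   so all sums can be cut at one bound [L] and then exchanged and reindexed. *)
move=> hom_f le_D le_sr; pose L := (r + s + w).+2.
pose TD i l := (shift d 1 (shift d (-1) f)`_l)`_i.
have TD0 i l : (w < i + l)%N -> TD i l = 0.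
  move=> lt_w; rewrite /TD; have [le_lw|lt_wl] := leqP l w.
    apply: (shift_large d_gt0 c_neq0 _ (homog_shift d_gt0 c_neq0 _ l hom_f)).
    by lia.
  by rewrite (shift_large d_gt0 c_neq0 _ hom_f) // rmorph0 coef0.
have size_f a : (size (shift d a f) <= L)%N.
  by apply: leq_trans (size_shift d_gt0 c_neq0 _ hom_f) _; rewrite /L; lia.
have S1 : vertex_adj r (vertex s f) = \sum_(m < L) \sum_(l < L) \sum_(i < L)
    if (i <= r + m)%N && (r + m - i <= s + l)%N then
      psi (r + m - i) *: (q (-1) m * q 1 (s + l - (r + m - i)) * TD i l)
    else 0.
  have hom_v := homog_vertex d_gt0 c_neq0 s hom_f.
  rewrite (@vertex_adjE _ _ _ _ L); last first.
    by apply: leq_trans (size_shift d_gt0 c_neq0 _ hom_v) _; rewrite /L; lia.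
  rewrite (vertexE c s (size_f _)) rmorph_sum /=.
  apply: eq_bigr => m _; rewrite coef_sum mulr_sumr; apply: eq_bigr => l _.
  rewrite rmorphM /= coefM (reindex_inj rev_ord_inj) /= mulr_sumr.
  pose F i := q (-1) m * ((shift d 1 (q 1 (s + l)))`_(r + m - i) * TD i l).
  transitivity (\sum_(i < (r + m).+1) F i).
    apply: eq_bigr => i _; have := ltn_ord i; rewrite ltnS => le_i.
    by rewrite /F /TD subSS subKn.
  rewrite (@big_ord_trunc _ _ L) => [|i le_Li]; last first.
    by rewrite /F TD0 ?mulr0 //; move: le_Li; rewrite /L; lia.
  rewrite big_mkcond; apply: eq_bigr => i _; rewrite ltnS.
  case: (i <= r + m)%N => //=; rewrite /F (shift_qseq d c_neq0) ?mulr1 //.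
  by case: ifP => _; rewrite ?mul0r ?mulr0 // -scalerAl -scalerAr mulrA.
(* In [S1] the shift by 1 moved past [q 1]; here the shift by -1 moves past [q (-1)]. Reindexing
   makes the normally ordered terms of both sums identical. *)
have S2 : vertex (s + eps) (vertex_adj (r + eps) f)
  = \sum_(m < L) \sum_(l < L) \sum_(i < L)
    if (r + eps + m <= i)%N then
      psi (i - (r + eps + m))
        *: (q (-1) m * q 1 (s + l + i - (r + m)) * TD i l)
    else 0.
  pose G j m l := psi j *: (q (-1) m * q 1 (s + eps + (l + j))
                             * TD (r + eps + (m + j))%N l).
  transitivity (\sum_(m < L) \sum_(l < L) \sum_(j < L) G j m l); last first.
    apply: eq_bigr => m _; apply: eq_bigr => l _; rewrite -big_mkcond /=.
    rewrite -(@big_ord_shift _ (fun j => G j m l) _ (r + eps + m)).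
      apply: eq_bigr => i le_i; congr (_ *: (_ * q 1 _ * TD _ _)); lia.
    move=> j le_L; rewrite /G TD0 ?mulr0 ?scaler0 //; move: le_L; rewrite /L.
    by lia.
  transitivity (\sum_(j < L) \sum_(m < L) \sum_(l < L) G j m l); last first.
    exact: (exchange_big3 G).
  transitivity (\sum_(j < L) \sum_(m < L | (j <= m)%N)
                  \sum_(l < L | (j <= l)%N) G j (m - j)%N (l - j)%N); last first.
    apply: eq_bigr => j _.
    have G0 m l : (L <= m + j)%N || (L <= l + j)%N -> G j m l = 0.
      move=> le_L; rewrite /G TD0 ?mulr0 ?scaler0 //.
      move: le_L; rewrite /L => /orP[]; case: (eps) => /=; lia.
    transitivity (\sum_(m < L | (j <= m)%N) \sum_(l < L) G j (m - j)%N l).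
      apply: eq_bigr => m _; apply: (big_ord_shift (F := G j (m - j)%N)) => l.
      by move=> le_L; rewrite G0 ?le_L ?orbT.
    apply: (big_ord_shift (F := fun m => \sum_(l < L) G j m l)) => m le_L.
    by rewrite big1 // => l _; rewrite G0 ?le_L.
  have size_v : (size (shift d (-1) (vertex_adj (r + eps) f)) <= L)%N.
    rewrite (vertex_adjE c _ (size_f _)).
    have hom_v : \sum_(m < L) q (-1) m * (shift d 1 f)`_(r + eps + m)
        \is hom (w - (r + eps))%N.
      apply: homog_sum => m _; have [le_w|lt_w] := leqP (r + eps + m) w.
        have -> : (w - (r + eps) = m + (w - (r + eps + m)))%N by lia.
        by apply: dhomogM;
           [exact: (homog_qseq d c_neq0)
           |exact: (homog_shift d_gt0 c_neq0 _ _ hom_f)].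
      by rewrite (shift_large d_gt0 c_neq0 _ hom_f) // mulr0 dhomog0.
    by apply: leq_trans (size_shift d_gt0 c_neq0 _ hom_v) _; rewrite /L; lia.
  rewrite (vertexE c _ size_v) (vertex_adjE c _ (size_f _)) rmorph_sum /=.
  rewrite [RHS](_ : _ = \sum_(l < L) \sum_(m < L) \sum_(j < L)
     if (j <= l)%N && (j <= m)%N then G j (m - j)%N (l - j)%N else 0).
    apply: eq_bigr => l _; rewrite coef_sum mulr_sumr; apply: eq_bigr => m _.
    rewrite rmorphM /= coefM mulr_sumr.
    have lt_l := ltn_ord l.
    rewrite (big_ord_widen L (fun j => q 1 (s + eps + l)%N *
      ((shift d (-1) (q (-1) m))`_j *
      (shift d (-1) (shift d 1 f)`_(r + eps + m))`_(l - j)))) //.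
    rewrite big_mkcond; apply: eq_bigr => j _; rewrite ltnS.
    case: leqP => //= le_jl.
    have sq1 : (-1) * (-1) = 1 :> C by rewrite mulrNN mulr1.
    have e := shift_qseq d c_neq0 j m sq1.
    rewrite [X in _ * (X * _)]e.
    case: ifP => le_jm; last by rewrite mul0r mulr0.
    rewrite /G -scalerAl -scalerAr subnK // subnK // mulrA [q 1 _ * _]mulrC.
    by rewrite (shiftC d_gt0 c_neq0).
  rewrite [RHS]exchange_big /=.
  under [RHS]eq_bigr do rewrite exchange_big.
  rewrite [RHS]exchange_big; apply: eq_bigr => j _ /=.
  rewrite big_mkcond; apply: eq_bigr => m _ /=.
  case: leqP => le_jm; last by rewrite big1 // => l _; rewrite andbF.
  by rewrite big_mkcond; apply: eq_bigr => l _; rewrite andbT.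
(* Each term gets total weight [c]: from [S1] alone if [i < r + m], from [S2] alone if [i > r + m].
   At [i = r + m] the first sum gives [psi 0 = 1], and the second gives another 1 exactly when [eps]
   is false, where [c = 2]. *)
transitivity (c *: \sum_(l < L) \sum_(i < L)
    \sum_(m < L | (r + m <= s + l + i)%N)
      q (-1) m * q 1 (s + l + i - (r + m)) * TD i l).
  transitivity (\sum_(m < L) \sum_(l < L) \sum_(i < L)
      if (r + m <= s + l + i)%N then
        c *: (q (-1) m * q 1 (s + l + i - (r + m)) * TD i l) else 0); last first.
    rewrite exchange_big scaler_sumr; apply: eq_bigr => l _.
    rewrite exchange_big scaler_sumr; apply: eq_bigr => i _.
    by rewrite -big_mkcond scaler_sumr.
  rewrite S1 S2 -big_split; apply: eq_bigr => m _; rewrite -big_split.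
  apply: eq_bigr => l _; rewrite -big_split; apply: eq_bigr => i _ /=.
  have [lt_w|le_w] := ltnP w (i + l)%N.
    by rewrite TD0 // !mulr0 !scaler0 !if_same addr0.
  have [le_rm|lt_rm] := leqP (r + m) (s + l + i); last first.
    rewrite !ifN ?addr0 //; first by case: eps; lia.
    by apply/negP => /andP[]; lia.
  have [lt_i|le_i] := ltnP i (r + m).
    rewrite [X in X + _]ifT; last by lia.
    rewrite psi_value; last by lia.
    rewrite ifN; last by lia.
    rewrite ifN ?addr0; last by lia.
    by congr (_ *: (_ * q 1 _ * _)); lia.
  have [gt_i|le_i'] := ltnP (r + m) i.
    rewrite /= add0r.
    rewrite ifT; last by case: (eps); lia.
    rewrite psi_value; last by lia.
    rewrite (_ : (if _ then 1 else c) = c) //; case: ifP => //.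
    by case: (eps) => //; rewrite ?subn1 //; lia.
  have -> : i = (r + m)%N :> nat by lia.
  rewrite /= subnn leq0n psi_value // eqxx subn0.
  rewrite (_ : s + l + (r + m) - (r + m) = s + l)%N; last by lia.
  have [le_eps|lt_eps] := leqP (r + eps + m) (r + m); last first.
    have eps1 : (2 - eps)%N = 1%N by lia.
    by rewrite addr0 eps1.
  have eps0 : (2 - eps)%N = 2%N by lia.
  have -> : (r + m - (r + eps + m) = 0)%N by lia.
  by rewrite psi_value // eqxx eps0 -scalerDl.
(* Summing over [m] convolves [q (-1)] with [q 1], so only the diagonal [l + i = r - s] survives;
   [shift_inv] then evaluates it. *)
under eq_bigr => l _.
  under eq_bigr => i _.
    rewrite -mulr_suml.
    rewrite (_ : _ * _ = if (l == r - s - i :> nat)%N && (i <= r - s)%N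
                         then TD i l else 0); last first.
      have [lt_w|le_w] := ltnP w (i + l)%N.
        by rewrite TD0 // mulr0 if_same.
      have [le_r|lt_r] := leqP r (s + l + i); last first.
        rewrite big1 ?mul0r => [|m]; last by lia.
        by rewrite ifN //; lia.
      rewrite (eq_bigl (fun m : 'I_L => (m < (s + l + i - r).+1)%N)); last first.
        by move=> m; lia.
      rewrite (eq_bigr (fun m : 'I_L => q (-1) m * q 1 (s + l + i - r - m)%N)).
        rewrite -(big_ord_widen L (fun m => q (-1) m * q 1 (s + l + i - r - m)));
          last first.
          move: le_w le_r; rewrite /L.
          by move: (i : nat) (l : nat) => i' l' le_w' le_r'; clear -le_w' le_r'; lia.
        have := qseq_conv d c (-1) (s + l + i - r)%N; rewrite opprK /conv => ->.
        case: eqP => e; first by rewrite mul1r ifT //; lia.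
        by rewrite mul0r ifN //; lia.
      by move=> m _; congr (_ * q 1 _); lia.
    over.
  over.
rewrite exchange_big /=.
rewrite (_ : \sum_(i < L) _ = \sum_(i < (r - s).+1) TD i (r - s - i)%N); last first.
  rewrite (big_ord_widen L (fun i => TD i (r - s - i)%N)); last by rewrite /L; lia.
  rewrite [RHS]big_mkcond; apply: eq_bigr => i _; rewrite ltnS.
  case: leqP => le_i; last by rewrite big1 // => l _; rewrite andbF.
  have lt_L : (r - s - i < L)%N by rewrite /L; lia.
  rewrite (bigD1 (Ordinal lt_L)) //= eqxx big1 ?addr0 // => l ne_l.
  by rewrite andbT ifN.
rewrite (shift_inv d_gt0 c_neq0 1) subn_eq0.
have -> : (r <= s)%N = (r == s) by rewrite eqn_leq le_sr andbT.
by case: eqP => _; rewrite ?mulr1n // mulr0n scaler0.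
Qed.

(* Neighbouring parts of an admissible sequence satisfy [b < a + eps]:
   partitions for [eps = true], strict partitions for [eps = false]. *)
Definition admissible (al : seq nat) : bool :=
  pairwise (fun a b => b < a + eps)%N al && all (leq 1) al.

Definition vertex_fun (al : seq nat) : {mpoly C[K]} := foldr vertex 1 al.

Lemma homog_vertex_fun al : vertex_fun al \is hom (sumn al).
Proof.
elim: al => [|a al IHal] /=; first exact: dhomog1.
exact: homog_vertex c_neq0 _ _ _ IHal.
Qed.

(** Since [r] exceeds the head, the relation moves the adjoint past it without a scalar term and
    raises its index to [r + eps], still above all remaining parts; at the end it annihilates 1. *)
Lemma vertex_adj_vanish r al : (0 < r)%N -> (sumn al <= D)%N -> admissible al ->
  all (gtn r) al -> vertex_adj r (vertex_fun al) = 0.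
Proof.
elim: al r => [|a al IHal] r r_gt0 /= le_D.
  rewrite /vertex_adj rmorph1 size_poly1 big_ord1 addn0 coef1.
  by rewrite eqn0Ngt r_gt0 mulr0.
case/andP=> /andP[/allP al_a pw_al] /andP[a_gt0 al_gt0] /andP[lt_ar /allP al_r].
have := vertex_relation (homog_vertex_fun al) le_D (ltnW lt_ar).
rewrite [vertex_adj (r + eps) _]IHal ?vertex0 ?addr0.
- by rewrite gtn_eqF.
- by rewrite (leq_trans r_gt0) ?leq_addr.
- by apply: leq_trans le_D; apply: leq_addl.
- by apply/andP.
- by apply/allP => b /al_r /= /leq_trans; apply; apply: leq_addr.
Qed.

(** Admissibility bounds the tail by [b < a + eps], just what lets the exchanged term
    [vertex_adj (a + eps)] annihilate it. *)
Lemma vertex_adj_head a al : (sumn (a :: al) <= D)%N -> admissible (a :: al) ->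
  vertex_adj a (vertex_fun (a :: al)) = c *: vertex_fun al.
Proof.
move=> /= le_D /andP[/andP[al_a pw_al] /andP[a_gt0 al_gt0]].
have := vertex_relation (homog_vertex_fun al) le_D (leqnn a).
rewrite eqxx [vertex_adj (a + eps) _]vertex_adj_vanish ?vertex0 ?addr0 //.
- by rewrite (leq_trans a_gt0) ?leq_addr.
- by apply: leq_trans le_D; apply: leq_addl.
- by apply/andP.
Qed.

Theorem vertex_fun_orthogonal al be : (sumn al <= D)%N -> (sumn be <= D)%N ->
  admissible al -> admissible be ->
  ip d c (vertex_fun al) (vertex_fun be)
    = if al == be then c ^+ size al else 0.
Proof.
elim: al be => [|a al IHal] be.
  elim: be => [|b be _] _ le_D _ adm_be.
    by rewrite eqxx expr0 /= -mpolyX0 ip_monomial mcoeffX eqxx mulr1 /ipw big1 //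
       => k _; rewrite mnm0E expr0 mul1r.
  rewrite ipC /= (ip_vertex d_gt0 c_neq0 _ (homog_vertex_fun be) (dhomog1 _ _)).
  rewrite [vertex_adj b 1](@vertex_adj_vanish b [::]) ?linear0 //.
  by case/andP: adm_be => _ /andP[].
case: be => [|b be] le_D le_D' adm_al adm_be.
  rewrite /= (ip_vertex d_gt0 c_neq0 _ (homog_vertex_fun al) (dhomog1 _ _)).
  rewrite [vertex_adj a 1](@vertex_adj_vanish a [::]) ?linear0 //.
  by case/andP: adm_al => _ /andP[].
have adm_tl x l : admissible (x :: l) -> admissible l.
  by case/andP=> /andP[_ pw] /andP[_ ps]; apply/andP.
have le_tl x l : (sumn (x :: l) <= D)%N -> (sumn l <= D)%N.
  by apply: leq_trans; apply: leq_addl.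
have neq_case a' b' al' be' : (b' < a')%N -> (sumn (a' :: al') <= D)%N ->
    (sumn (b' :: be') <= D)%N -> admissible (a' :: al') ->
    admissible (b' :: be') ->
    ip d c (vertex_fun (a' :: al')) (vertex_fun (b' :: be')) = 0.
  move=> lt_ba leD1 leD2 adm1 adm2; rewrite [vertex_fun (a' :: _)]/=.
  rewrite (ip_vertex d_gt0 c_neq0 _ (homog_vertex_fun al') (homog_vertex_fun _)).
  rewrite vertex_adj_vanish ?linear0 ?(leq_ltn_trans _ lt_ba) //=.
  rewrite lt_ba; case/andP: adm2 => /andP[/allP be_b _] _.
  by apply/allP => x /be_b /= lt_x; case: eps lt_x => /=; lia.
have [lt_ab|lt_ba|eq_ab] := ltngtP a b.
- by rewrite ipC neq_case // eqseq_cons ltn_eqF.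
- by rewrite neq_case // eqseq_cons gtn_eqF.
rewrite -{b}eq_ab in le_D' adm_be *; rewrite eqseq_cons eqxx /=.
have -> : ip d c (vertex a (vertex_fun al)) (vertex a (vertex_fun be))
    = ip d c (vertex_fun al) (vertex_adj a (vertex_fun (a :: be))).
  exact: (ip_vertex d_gt0 c_neq0 _ (homog_vertex_fun al)
            (homog_vertex_fun (a :: be))).
rewrite vertex_adj_head // ip_mulrZ.
rewrite (IHal _ (le_tl _ _ le_D) (le_tl _ _ le_D') (adm_tl _ _ adm_al)
  (adm_tl _ _ adm_be)).
by case: ifP; rewrite ?mulr0 // exprS.
Qed.

End VertexRelation.

(** * Evaluation at points *)

Lemma conv_cancel (R : comNzRingType) (a a' b : nat -> R) M : b 0%N = 1 ->
  (forall n, (n <= M)%N -> conv a b n = conv a' b n) ->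
  forall n, (n <= M)%N -> a n = a' n.
Proof.
move=> b0 eq_ab n; elim/ltn_ind: n => n IHn le_nM.
have := eq_ab n le_nM; rewrite /conv !big_ord_recr /= subnn b0 !mulr1.
rewrite (eq_bigr (fun i : 'I_n => a' i * b (n - i)%N)) => [/addrI //|i _].
by rewrite IHn // (leq_trans _ le_nM) // ltnW.
Qed.

Section PartialFractions.
Variables (F : fieldType) (N : nat) (x : 'I_N -> F) (t : F).
Hypotheses (x_inj : injective x) (x_neq0 : forall i, x i != 0).

(** The coefficient of [1 / (1 - x_i u)] in the partial fractions of
    [prod_j (1 - t x_j u) / (1 - x_j u)]. *)
Definition residue (i : 'I_N) : F :=
  (1 - t) * \prod_(j | j != i) ((x i - t * x j) / (x i - x j)).

Lemma sub_neq0 i j : j != i -> x i - x j != 0.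
Proof. by move=> ne_ji; rewrite subr_eq0 (inj_eq x_inj) eq_sym. Qed.

(** Both sides have degree at most [N] and agree at the [N + 1] distinct points 0 and [1 / x_i];
    agreement at 0 dictates the constant [1 - sum_i residue i]. *)
Lemma prod_partial_fractions :
  \prod_i (1 - (t * x i) *: 'X)
    = (1 - \sum_i residue i) *: \prod_i (1 - x i *: 'X)
      + \sum_i residue i *: \prod_(j | j != i) (1 - x j *: 'X) :> {poly F}.
Proof.
have size_lin (a : F) : (size (1 - a *: 'X : {poly F})%R <= 2)%N.
  rewrite (leq_trans (size_polyD _ _)) // size_poly1 geq_max /= size_polyN.
  by rewrite (leq_trans (size_scale_leq _ _)) // size_polyX.
have size_prodl (a : 'I_N -> F) (P : pred 'I_N) :
    (size (\prod_(i | P i) (1 - a i *: 'X))%R <= N.+1)%N.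
  rewrite (leq_trans (size_prod_leq _ _)) // leq_subLR.
  apply: (@leq_trans (\sum_(i | P i) 2).+1).
    by rewrite ltnS leq_sum.
  rewrite sum_nat_const; have := max_card P; rewrite card_ord; lia.
apply/eqP; rewrite -subr_eq0; set p := _ - _; apply/negPn/negP => p_neq0.
pose rs := 0 :: [seq (x i)^-1 | i : 'I_N].
have Urs : uniq rs.
  rewrite /= map_inj_uniq ?enum_uniq ?andbT => [|i j /invr_inj/x_inj //].
  apply/negP => /mapP[i _ /eqP]; rewrite eq_sym invr_eq0.
  exact/negP.
have hornerE' (a : 'I_N -> F) (P : pred 'I_N) z :
    (\prod_(i | P i) (1 - a i *: 'X)).[z] = \prod_(i | P i) (1 - a i * z).
  by rewrite horner_prod; apply: eq_bigr => i _; rewrite !hornerE.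
have pE z : p.[z] = \prod_i (1 - t * x i * z)
    - ((1 - \sum_i residue i) * \prod_i (1 - x i * z)
       + \sum_i residue i * \prod_(j | j != i) (1 - x j * z)).
  rewrite /p hornerD hornerN hornerD hornerZ !hornerE' horner_sum.
  by congr (_ - (_ + _)); apply: eq_bigr => i _; rewrite hornerZ hornerE'.
have all_rs : all (root p) rs.
  apply/andP; split.
    rewrite /root pE; apply/eqP.
    have prod1 (a : 'I_N -> F) (P : pred 'I_N) :
      \prod_(i | P i) (1 - a i * 0) = 1.
      by rewrite big1 // => i _; rewrite mulr0 subr0.
    rewrite big1 => [|i _]; last by rewrite mulr0 subr0.
    rewrite (prod1 x) mulr1.
    rewrite [X in _ - (_ + X)](eq_bigr residue) => [|i _].
      by rewrite subrK subrr.
    by rewrite big1 ?mulr1 // => j _; rewrite mulr0 subr0.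
  apply/allP => _ /mapP[i _ ->]; rewrite /root pE; apply/eqP.
  have prod0 (P : pred 'I_N) : P i -> \prod_(j | P j) (1 - x j * (x i)^-1) = 0.
    by move=> Pi; rewrite (bigD1 i) //= divff // subrr mul0r.
  rewrite prod0 // mulr0 add0r [X in _ - X](bigD1 i) //=.
  rewrite [X in _ - (_ + X)]big1 ?addr0; last first.
    by move=> j ne_ji; rewrite prod0 ?mulr0 // eq_sym.
  rewrite (bigD1 i) //= mulfK // /residue -mulrA -big_split /=.
  apply/eqP; rewrite subr_eq0; apply/eqP; congr (_ * _).
  apply: eq_bigr => j ne_ji; have := sub_neq0 ne_ji; have := x_neq0 i.
  by move=> ? ?; field; apply/andP.
have := max_poly_roots p_neq0 all_rs Urs; rewrite /= size_map size_enum_ord.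
rewrite ltnNge => /negP; apply.
rewrite (leq_trans (size_polyD _ _)) // geq_max size_polyN.
rewrite (leq_trans (size_prodl _ _)) //=.
rewrite (leq_trans (size_polyD _ _)) // geq_max.
rewrite (leq_trans (size_scale_leq _ _)) ?(leq_trans (size_prodl _ _)) //=.
rewrite (leq_trans (size_sum _ _ _)) //; apply/bigmax_leqP => i _.
by rewrite (leq_trans (size_scale_leq _ _)) ?(leq_trans (size_prodl _ _)).
Qed.

Hypothesis F_tfree : forall (y : F) n, y *+ n.+1 = 0 -> y = 0.

(* The coefficients of prod_i (1 - t x_i u) / (1 - x_i u). *)
Lemma newton_residue (p h : nat -> F) M : newton p h ->
  (forall k, (k < M)%N ->
     p k.+1 = (1 - t ^+ k.+1) * \sum_i x i ^+ k.+1) ->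
  forall n, (0 < n <= M)%N -> h n = \sum_i residue i * x i ^+ n.
Proof.
move=> newt_h eq_p n /andP[n_gt0 le_nM].
pose b m := (\prod_i (1 - x i *: 'X : {poly F}))`_m.
(* The formula fails in general at 0, where the coefficient is 1. The correction makes [e] the
   complete coefficient sequence, which can be compared after multiplication by [b]. *)
pose e (m : nat) := (1 - \sum_i residue i) * (m == 0%N)%:R + \sum_i residue i * x i ^+ m.
have newt_b : newton (fun k => - \sum_i x i ^+ k) b by apply: newton_prod.
have eE : e n = \sum_i residue i * x i ^+ n.
  by rewrite /e eqn0Ngt n_gt0 mulr0 add0r.
rewrite -eE; apply: (conv_cancel (b := b) (M := M)) => //; first by case: newt_b.
move=> {le_nM n_gt0 eE}m le_mM.
transitivity (\prod_i (1 - (t * x i) *: 'X : {poly F}))`_m.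
  have newt := newton_conv newt_h newt_b.
  apply: (newton_uniq_leq (M := M) F_tfree _ newt (newton_prod _ _ _)) => // k lt_kM.
  rewrite eq_p // mulrBl mul1r addrAC subrr add0r mulr_sumr; congr (- _).
  by apply: eq_bigr => i _; rewrite exprMn.
rewrite prod_partial_fractions coefD coefZ coef_sum /conv.
have -> : \sum_(i < m.+1) e i * b (m - i)%N
  = (1 - \sum_i residue i) * \sum_(i < m.+1) ((i : nat) == 0%N)%:R * b (m - i)%N
    + \sum_j residue j * \sum_(i < m.+1) x j ^+ i * b (m - i)%N.
  under eq_bigr do rewrite /e mulrDl.
  rewrite big_split /=; congr (_ + _).
    by rewrite mulr_sumr; apply: eq_bigr => i _; rewrite mulrA.
  under eq_bigr do rewrite mulr_suml.
  rewrite exchange_big; apply: eq_bigr => j _ /=.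
  by rewrite mulr_sumr; apply: eq_bigr => i _; rewrite mulrA.
rewrite [X in _ * X + _](_ : _ = b m); last exact: conv_delta.
congr (_ + _); apply: eq_bigr => i _; rewrite coefZ; congr (_ * _).
have newt := newton_conv (newton_geometric (x i)) newt_b.
have {newt} newt : newton (fun k => - \sum_(j | j != i) x j ^+ k)
    (conv (fun k => x i ^+ k) b).
  apply: eq_newton newt => // k.
  by rewrite (bigD1 i) //= opprD addrA subrr add0r.
exact: esym (newton_uniq F_tfree newt (newton_prod _ _ _) m).
Qed.

End PartialFractions.

Section Evaluation.
Variables (C : numFieldType) (F : fieldType) (iota : {rmorphism C -> F}).
Variables (K : nat) (d : 'I_K -> nat) (eps : bool) (D : nat).
Local Notation c := ((2 - eps)%:R : C).
Local Notation t := (1 - c).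
Hypothesis d_gt0 : forall k, (0 < d k)%N.
Hypothesis d_count : forall k, (k < D)%N ->
  c *+ #|[pred j | d j == k.+1]| = 1 - t ^+ k.+1.
Implicit Type f : {mpoly C[K]}.

Definition ev N (x : 'I_N -> F) : {mpoly C[K]} -> F :=
  mmap iota (fun k => \sum_i x i ^+ d k).
HB.instance Definition _ N (x : 'I_N -> F) := GRing.RMorphism.on (ev x).

Lemma evZ N (x : 'I_N -> F) a f : ev x (a *: f) = iota a * ev x f.
Proof. exact: mmapZ. Qed.

Lemma evC N (x : 'I_N -> F) a : ev x a%:MP = iota a.
Proof. exact: mmapC. Qed.

Lemma evX N (x : 'I_N -> F) k : ev x 'X_k = \sum_i x i ^+ d k.
Proof. by rewrite /ev mmapX mmap1U. Qed.

Lemma char0_torsion_free (y : F) n : y *+ n.+1 = 0 -> y = 0.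
Proof.
rewrite -mulr_natr -(rmorph_nat iota) => /eqP; rewrite mulf_eq0 fmorph_eq0.
by rewrite pnatr_eq0 orbF => /eqP.
Qed.

(** [p_k(x) - x_i^k] is the power sum of the other variables. *)
Lemma ev_shift N (x : 'I_N.+1 -> F) i f :
  (map_poly (ev x) (shift d (-1) f)).[x i] = ev (x \o lift i) f.
Proof.
elim/mpoly_mulX_ind: f => [|f g IHf IHg|a f IHf|k f IHf].
- by rewrite !rmorph1 hornerE.
- rewrite [shift _ _ _]rmorphD [map_poly _ _]rmorphD hornerD [RHS]rmorphD.
  by congr (_ + _); [exact: IHf | exact: IHg].
- rewrite shiftZ evZ -mul_polyC rmorphM /= hornerM map_polyC hornerC IHf.
  by rewrite /= evC.
rewrite [shift _ _ _]rmorphM [map_poly _ _]rmorphM hornerM [RHS]rmorphM.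
congr (_ * _); last exact: IHf.
rewrite /= shiftX [map_poly _ _]rmorphD hornerD /= map_polyC hornerC.
rewrite -mul_polyC [map_poly _ _]rmorphM hornerM /= map_polyC map_polyXn.
rewrite hornerC hornerXn /= !evX evC rmorphN1 mulN1r.
by rewrite (bigD1_ord i) //= addrAC subrr add0r.
Qed.

(* This is the recursion obtained from the symmetrisation formulas for
   Schur functions (t = 0) and Q-functions (t = -1) by singling out the variable
   that carries the largest part. *)
Lemma ev_vertex N (x : 'I_N.+1 -> F) r w f : injective x ->
  (forall i, x i != 0) -> f \is ishomog1 w (weight d) -> (0 < r)%N ->
  (r + w <= D)%N ->
  ev x (vertex d c r f)
    = \sum_i residue x (iota t) i * x i ^+ r * ev (x \o lift i) f.
Proof.
move=> x_inj x_neq0 hom_f r_gt0 le_D.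
have c_neq0 := two_sub_neq0 C eps.
rewrite (vertexE c r (size_shift d_gt0 c_neq0 (-1) hom_f)) rmorph_sum /=.
have ev_q l : (l < w.+1)%N ->
    ev x (qseq d c 1 (r + l)) = \sum_i residue x (iota t) i * x i ^+ (r + l).
  move=> lt_lw; have newt := newton_morph (ev x) (newton_qseq d c 1).
  apply: (newton_residue (M := D) x_inj x_neq0 char0_torsion_free newt); last first.
    by rewrite addn_gt0 r_gt0 /=; lia.
  move=> k lt_kD /=; rewrite evZ rmorph_sum mul1r /=.
  under eq_bigr => j /eqP dj do rewrite evX dj.
  rewrite sumr_const mulrnAr -mulrnAl -[_ *+ #|_|]rmorphMn /= d_count //.
  by rewrite rmorphB rmorph1 rmorphXn.
under eq_bigr => l _ do rewrite rmorphM /= ev_q ?ltn_ord // mulr_suml.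
rewrite exchange_big; apply: eq_bigr => i _ /=.
rewrite -ev_shift (@horner_coef_wide _ w.+1); last first.
  by rewrite (leq_trans (size_poly _ _)) // (size_shift d_gt0 c_neq0).
rewrite mulr_sumr; apply: eq_bigr => l _.
by rewrite coef_map /= exprD; ring.
Qed.

End Evaluation.

(** * Alternants and Hall-Littlewood sums *)

Section Alternant.
Variables (F : fieldType).

Definition alt_det N (x : 'I_N -> F) (e : 'I_N -> nat) : F :=
  \det (\matrix_(i < N, j < N) x i ^+ e j).

Lemma eq_alt_det N (x : 'I_N -> F) (e e' : 'I_N -> nat) :
  e =1 e' -> alt_det x e = alt_det x e'.
Proof.
by move=> eq_e; congr (\det _); apply/matrixP => i j; rewrite !mxE eq_e.
Qed.

Definition delta N (j : 'I_N) : nat := (N - j.+1)%N.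

Lemma alt_det_expand N (x : 'I_N.+1 -> F) (e : 'I_N.+1 -> nat) :
  alt_det x e = \sum_i x i ^+ e ord0
    * ((-1) ^+ i * alt_det (x \o lift i) (e \o lift ord0)).
Proof.
rewrite /alt_det (expand_det_col _ ord0); apply: eq_bigr => i _.
rewrite mxE /cofactor addn0; congr (_ * (_ * \det _)).
by apply/matrixP => a b; rewrite !mxE.
Qed.

(* Replacing the first column x_i ^ N by p(x_i), for a monic [p] of degree N
   that vanishes at the other points, does not change the determinant. *)
Lemma alt_det_delta_lift N (x : 'I_N.+1 -> F) (k : 'I_N.+1) :
  alt_det x (@delta N.+1) = (-1) ^+ k
    * \prod_(j | j != k) (x k - x j) * alt_det (x \o lift k) (@delta N).
Proof.
pose p : {poly F} := \prod_(j | j != k) ('X - (x j)%:P).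
have size_p : size p = N.+1.
  rewrite /p -big_filter size_prod_XsubC size_filter; congr _.+1.
  transitivity #|predC1 k|; last by rewrite cardC1 card_ord.
  by rewrite -sum1_card -sum1_count.
have lead_p : p`_N = 1.
  have : p \is monic by apply: monic_prod => j _; apply: monicXsubC.
  by rewrite monicE lead_coefE size_p => /eqP.
pose U : 'M[F]_N.+1 := \matrix_(a, b)
  if b == ord0 then p`_(N - a) else (a == b)%:R.
pose M := \matrix_(i < N.+1, j < N.+1) x i ^+ @delta N.+1 j.
have det_U : \det U = 1.
  rewrite det_trig => [|]; last first.
    apply/is_trig_mxP => a b lt_ab; rewrite mxE ifN.
      by rewrite -(inj_eq val_inj) ltn_eqF.
    by rewrite -(inj_eq val_inj) /= -lt0n (leq_ltn_trans _ lt_ab).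
  rewrite big1 // => a _; rewrite mxE eqxx.
  by case: eqP => // ->; rewrite subn0 lead_p.
have -> : alt_det x (@delta N.+1) = \det (M *m U) by rewrite det_mulmx det_U mulr1.
rewrite (expand_det_col _ ord0) (bigD1 k) //= big1 ?addr0.
  have MU0 i : (M *m U) i ord0 = p.[x i].
    rewrite mxE (horner_coef_wide _ (n := N.+1)) ?size_p //.
    rewrite [RHS](reindex_inj rev_ord_inj); apply: eq_bigr => j _ /=.
    by rewrite !mxE eqxx mulrC /delta subSS.
  rewrite MU0 horner_prod /cofactor addn0.
  under eq_bigr do rewrite hornerXsubC.
  rewrite mulrCA mulrA; congr (_ * \det _).
  apply/matrixP => a b; rewrite !mxE (bigD1 (lift ord0 b)) //= big1 ?addr0.
    by rewrite !mxE /= eqxx mulr1 /delta /= subSS.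
  by move=> j ne_j; rewrite !mxE /= (negbTE ne_j) mulr0.
move=> i ne_ik; rewrite mxE.
rewrite [X in X * _](_ : _ = p.[x i]).
  by rewrite horner_prod (bigD1 i) //= hornerXsubC subrr !mul0r.
rewrite (horner_coef_wide _ (n := N.+1)) ?size_p //.
rewrite [RHS](reindex_inj rev_ord_inj); apply: eq_bigr => j _ /=.
by rewrite !mxE eqxx mulrC /delta subSS.
Qed.

Variables (C : numFieldType) (iota : {rmorphism C -> F}).
Variables (K : nat) (d : 'I_K -> nat) (D : nat).
Hypothesis d_gt0 : forall k, (0 < d k)%N.
Hypothesis d_count : forall k, (k < D)%N ->
  ((2 - true)%:R : C) *+ #|[pred j | d j == k.+1]|
    = 1 - (1 - (2 - true)%:R) ^+ k.+1.

(** Expanding along the column of the largest part matches [ev_vertex]: at t = 0 the residue has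
    denominator [prod_(j != i) (x_i - x_j)], which the Vandermonde factorisation cancels, and its
    numerator is the power of [x_i] contributed by [delta]. *)
Lemma alternant_vertex_fun N (x : 'I_N -> F) lam : injective x ->
  (forall i, x i != 0) -> (size lam <= N)%N -> all (leq 1) lam ->
  (sumn lam <= D)%N ->
  alt_det x (fun j => nth 0 lam j + @delta N j)%N
    = ev iota d x (vertex_fun C d true lam) * alt_det x (@delta N).
Proof.
elim: lam N x => [|r mu IHmu] N x x_inj x_neq0.
  move=> _ _ _; rewrite /= rmorph1 mul1r; apply: eq_alt_det => j.
  by rewrite nth_nil.
case: N x x_inj x_neq0 => // N x x_inj x_neq0 /= le_N /andP[r_gt0 mu_gt0] le_D.
rewrite alt_det_expand (ev_vertex iota d_gt0 d_count x_inj x_neq0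
  (homog_vertex_fun C true d_gt0 mu) r_gt0 le_D) mulr_suml.
apply: eq_bigr => i _ /=.
have lift_inj' : injective (x \o lift i) by apply: inj_comp x_inj lift_inj.
have := IHmu N _ lift_inj' (fun j => x_neq0 _) le_N mu_gt0
  (leq_trans (leq_addl _ _) le_D).
rewrite (eq_alt_det _ (e' := (fun j : 'I_N.+1 =>
  nth 0 (r :: mu) j + @delta N.+1 j)%N \o lift ord0)); last first.
  by move=> j; rewrite /= /delta subSS.
move=> ->; rewrite (alt_det_delta_lift x i) exprD /residue.
have -> : iota (1 - (2 - 1)%:R) = 0.
  by rewrite [X in _ - X](_ : _ = 1) // subrr rmorph0.
have -> : x i ^+ @delta N.+1 ord0 = \prod_(j | j != i) x i.
  rewrite prodr_const; congr (_ ^+ _).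
  by rewrite (cardC1 i) card_ord /delta subSS subn0.
have -> : \prod_(j | j != i) x i = \prod_(j | j != i)
     ((x i - 0 * x j) / (x i - x j)) * \prod_(j | j != i) (x i - x j).
  rewrite -big_split; apply: eq_bigr => j ne_ji /=.
  by rewrite mul0r subr0 divfK // sub_neq0.
ring.
Qed.

End Alternant.

Section SumLiftPerm.
Variables (V : nmodType) (N : nat).

Lemma sum_lift_perm (G : 'S_N.+1 -> V) :
  \sum_w G w = \sum_i \sum_s G (lift_perm ord0 i s).
Proof.
rewrite pair_big /=.
have inj_lift : injective (fun p : 'I_N.+1 * 'S_N => lift_perm ord0 p.1 p.2).
  move=> [i s] [j s'] /= eq_w.
  have eq_ij : i = j by rewrite -(lift_perm_id ord0 i s) eq_w lift_perm_id.
  rewrite -{j}eq_ij in eq_w *; congr (_, _); apply/permP => k.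
  by apply: (@lift_inj _ i); rewrite -!(lift_perm_lift ord0) eq_w.
rewrite (reindex (fun p : 'I_N.+1 * 'S_N => lift_perm ord0 p.1 p.2)) //=.
apply/onW_bij/inj_card_bij => //.
by rewrite card_prod !card_Sn card_ord factS.
Qed.

End SumLiftPerm.

Section HallLittlewoodSum.
Variable (F : fieldType).

Definition hl_sum N (x : 'I_N -> F) (t : F) (lam : seq nat) : F :=
  \sum_(w : 'S_N)
    (\prod_(i < N) x (w i) ^+ nth 0%N lam i)
    * \prod_(i < N) \prod_(j < N | (nth 0%N lam j < nth 0%N lam i)%N)
        ((x (w i) - t * x (w j)) / (x (w i) - x (w j))).

Definition stab N (lam : seq nat) : nat :=
  #|[set w : 'S_N | [forall i, nth 0%N lam (w i) == nth 0%N lam i]]|.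

Lemma stab_gt0 N lam : (0 < stab N lam)%N.
Proof.
by apply/card_gt0P; exists 1%g; rewrite inE; apply/forallP => i; rewrite perm1.
Qed.

Lemma nth_lt r mu i : (0 < r)%N -> all (gtn r) mu -> (nth 0%N mu i < r)%N.
Proof.
move=> r_gt0 /all_nthP mu_r; have [lt_i|le_i] := ltnP i (size mu).
  exact: mu_r.
by rewrite nth_default.
Qed.

(** The value [r] occurs only at index 0, even after padding [mu] with zeros, so a stabilising
    permutation fixes 0. *)
Lemma stab_cons N r mu : (0 < r)%N -> all (gtn r) mu ->
  stab N.+1 (r :: mu) = stab N mu.
Proof.
move=> r_gt0 mu_r; rewrite /stab -!sum1_card big_mkcond /= [RHS]big_mkcond /=.
rewrite (sum_lift_perm (fun w => if w \in _ then 1%N else 0%N)) big_ord_recl.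
rewrite [X in _ + X]big1 ?addr0; last first.
  move=> i _; rewrite big1 // => s _; rewrite inE; case: forallP => // /(_ ord0).
  by rewrite lift_perm_id /= ltn_eqF // nth_lt.
apply: eq_bigr => s _; rewrite !inE; congr (if _ then _ else _).
apply/forallP/forallP => eq_s i.
  by have := eq_s (lift ord0 i); rewrite lift_perm_lift.
case: (unliftP ord0 i) => [j|] ->; last by rewrite lift_perm_id.
by rewrite lift_perm_lift; apply: eq_s.
Qed.

(** Permutations are grouped by the image [i] of index 0. As [r] is strictly largest, index 0 is
    paired with every other index, always as the larger one. *)
Lemma hl_sum_cons N (x : 'I_N.+1 -> F) t r mu : (0 < r)%N -> all (gtn r) mu ->
  hl_sum x t (r :: mu) = \sum_i
    \prod_(j | j != i) ((x i - t * x j) / (x i - x j))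
      * x i ^+ r * hl_sum (x \o lift i) t mu.
Proof.
move=> r_gt0 mu_r; rewrite /hl_sum sum_lift_perm; apply: eq_bigr => i _.
rewrite mulr_sumr; apply: eq_bigr => s _.
rewrite !big_ord_recl /= lift_perm_id.
rewrite [X in _ * (X * _)]big_mkcond big_ord_recl /= ltnn mul1r.
under eq_bigr => k _ do rewrite lift_perm_lift.
rewrite -big_mkcond /= [X in _ * (X * _)](_ : _
    = \prod_(j | j != i) ((x i - t * x j) / (x i - x j))); last first.
  rewrite [RHS]big_mkcond /= (bigD1_ord i) //= eqxx mul1r.
  rewrite [RHS](reindex_inj (@perm_inj _ s)) /= big_mkcond /=.
  apply: eq_bigr => k _; rewrite nth_lt // lift_perm_lift.
  by rewrite eq_sym neq_lift.
rewrite [X in _ * (_ * X)](_ : _ = \prod_(k < N)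
    \prod_(j < N | (nth 0%N mu j < nth 0%N mu k)%N)
      ((x (lift i (s k)) - t * x (lift i (s j)))
       / (x (lift i (s k)) - x (lift i (s j))))); last first.
  apply: eq_bigr => k _; rewrite big_mkcond big_ord_recl /= ltnNge.
  rewrite (ltnW (nth_lt _ r_gt0 mu_r)) /= mul1r [RHS]big_mkcond /=.
  by apply: eq_bigr => j _; rewrite !lift_perm_lift.
by ring.
Qed.

Variables (C : numFieldType) (iota : {rmorphism C -> F}).
Variables (K : nat) (d : 'I_K -> nat) (D : nat).
Hypothesis d_gt0 : forall k, (0 < d k)%N.
Hypothesis d_count : forall k, (k < D)%N ->
  ((2 - false)%:R : C) *+ #|[pred j | d j == k.+1]|
    = 1 - (1 - (2 - false)%:R) ^+ k.+1.

(** The recursion of [ev_vertex] at t = -1. Each residue carries a factor [1 - t = 2], whence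
    [2 ^+ size lam]; the stabiliser only permutes the zero padding and is the same at every
    stage. *)
Lemma hl_sum_vertex_fun N (x : 'I_N -> F) lam : injective x ->
  (forall i, x i != 0) -> (size lam <= N)%N -> admissible false lam ->
  (sumn lam <= D)%N ->
  2 ^+ size lam * hl_sum x (-1) lam
    = (stab N lam)%:R * ev iota d x (vertex_fun C d false lam).
Proof.
elim: lam N x => [|r mu IHmu] N x x_inj x_neq0.
  move=> _ _ _; rewrite expr0 mul1r rmorph1 mulr1 /hl_sum /stab.
  rewrite (eq_bigr (fun=> 1)) => [|w _].
    rewrite sumr_const; congr (_%:R); apply: eq_card => w; rewrite !inE.
    by apply/esym/forallP => i; rewrite !nth_nil.
  rewrite [X in X * _]big1 => [|i _]; last by rewrite nth_nil expr0.
  rewrite mul1r big1 // => i _; rewrite big1 // => j.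
  by rewrite !nth_nil ltnn.
case: N x x_inj x_neq0 => // N x x_inj x_neq0 /= le_N adm le_D.
have /andP[/andP[mu_r pw_mu] /andP[r_gt0 mu_gt0]] := adm.
have {}mu_r : all (gtn r) mu by apply: sub_all mu_r => b; rewrite addn0.
rewrite stab_cons // hl_sum_cons // (ev_vertex iota d_gt0 d_count x_inj x_neq0
  (homog_vertex_fun C false d_gt0 mu) r_gt0 le_D) !mulr_sumr.
apply: eq_bigr => i _ /=.
have lift_inj' : injective (x \o lift i) by apply: inj_comp x_inj lift_inj.
have adm_mu : admissible false mu by apply/andP.
have IH := IHmu N _ lift_inj' (fun j => x_neq0 _) le_N adm_mu
  (leq_trans (leq_addl _ _) le_D).
have -> : iota (1 - 2%:R) = -1.
  by rewrite rmorphB rmorph1 rmorph_nat; ring.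
rewrite /residue opprK exprS.
rewrite [RHS](_ : _ = (1 + 1)
   * \prod_(j | j != i) ((x i - -1 * x j) / (x i - x j)) * x i ^+ r
   * ((stab N mu)%:R * ev iota d (x \o lift i) (vertex_fun C d false mu))).
  by rewrite -IH; ring.
ring.
Qed.

Lemma HLb_strict lam : uniq lam -> all (leq 1) lam ->
  HLb (-1 : F) lam = 2 ^+ size lam.
Proof.
move=> Ulam lam_gt0; rewrite /HLb.
rewrite (eq_bigr (fun i => 2 ^+ (i \in lam))) => [|i _]; last first.
  rewrite count_uniq_mem //; case: (i \in lam); last by rewrite big_geq.
  by rewrite big_nat1 expr1 opprK.
rewrite prodrXr; congr (_ ^+ _).
rewrite -big_mkcond sum1_count -size_filter; apply: perm_size.
apply: uniq_perm; rewrite ?filter_uniq ?iota_uniq // => i.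
rewrite mem_filter mem_index_iota; case: (boolP (i \in lam)) => //= lam_i.
by rewrite ltnS mem_leq_sumn // (allP lam_gt0).
Qed.

Lemma HLQ_vertex_fun N (x : 'I_N -> F) lam : injective x ->
  (forall i, x i != 0) -> (size lam <= N)%N -> admissible false lam ->
  (sumn lam <= D)%N ->
  HLQ x (-1) lam = ev iota d x (vertex_fun C d false lam).
Proof.
move=> x_inj x_neq0 le_N adm le_D.
have Ulam : uniq lam.
  case/andP: adm => pw _; rewrite uniq_pairwise; apply: sub_pairwise pw.
  by move=> a b /=; rewrite addn0 eq_sym => /ltn_eqF->.
have stab_neq0 : (stab N lam)%:R != 0 :> F.
  by rewrite -(rmorph_nat iota) fmorph_eq0 pnatr_eq0 -lt0n stab_gt0.
have /andP[_ lam_gt0] := adm.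
rewrite /HLQ /HLP le_N HLb_strict // mulrCA hl_sum_vertex_fun //.
by rewrite mulKf.
Qed.

End HallLittlewoodSum.

(** * Schur functions and Q-functions in terms of power sums *)

Section PowerSumSubstitution.
Variables (C : numFieldType) (K : nat) (d : 'I_K -> nat).
Implicit Type f : {mpoly C[K]}.

(** The letters [y] are arbitrary polynomials so that one map serves the alphabets [x], [(x, x)] and
    [x^2]. *)
Definition psum_subst M N (y : 'I_M -> {mpoly C[N]}) f : {mpoly C[N]} :=
  mmap (@mpolyC N C) (fun k => \sum_i y i ^+ d k) f.
HB.instance Definition _ M N (y : 'I_M -> {mpoly C[N]}) :=
  GRing.RMorphism.copy (psum_subst y)
    (mmap (@mpolyC N C) (fun k => \sum_i y i ^+ d k)).

Lemma psum_substZ M N (y : 'I_M -> {mpoly C[N]}) a f :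
  psum_subst y (a *: f) = a *: psum_subst y f.
Proof. by rewrite [LHS]mmapZ mul_mpolyC. Qed.

Lemma psum_substX M N (y : 'I_M -> {mpoly C[N]}) k :
  psum_subst y 'X_k = \sum_i y i ^+ d k.
Proof. by rewrite /psum_subst mmapX mmap1U. Qed.

Lemma psum_substC M N (y : 'I_M -> {mpoly C[N]}) a :
  psum_subst y a%:MP = a%:MP.
Proof. exact: mmapC. Qed.

Lemma eq_psum_subst M N (y y' : 'I_M -> {mpoly C[N]}) f :
  y =1 y' -> psum_subst y f = psum_subst y' f.
Proof.
move=> eq_y; apply: eq_bigr => m _; congr (_ * _); apply: mmap1_eq => k.
by apply: eq_bigr => i _; rewrite eq_y.
Qed.

Lemma psum_subst_comp M N (t : M.-tuple {mpoly C[N]}) f :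
  psum_subst (fun i => 'X_i) f \mPo t = psum_subst (tnth t) f.
Proof.
elim/mpoly_mulX_ind: f => [|f g IHf IHg|a f IHf|k f IHf].
- by rewrite !rmorph1.
- by rewrite [psum_subst _ _]rmorphD [LHS]rmorphD [RHS]rmorphD;
    congr (_ + _); [exact: IHf | exact: IHg].
- by rewrite psum_substZ comp_mpolyZ psum_substZ; congr (_ *: _); exact: IHf.
rewrite [psum_subst _ _]rmorphM [LHS]rmorphM [RHS]rmorphM.
congr (_ * _); last exact: IHf.
rewrite /= !psum_substX raddf_sum; apply: eq_bigr => i _.
by rewrite /= rmorphXn /= comp_mpolyXU -tnth_nth.
Qed.

Lemma deriv_psum_subst N i f :
  (psum_subst (fun j : 'I_N => 'X_j) f)^`M(i)
    = \sum_k psum_subst (fun j => 'X_j) f^`M(k) * ((d k)%:R *: 'X_i ^+ (d k).-1).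
Proof.
elim/mpoly_mulX_ind: f => [|f g IHf IHg|a f IHf|k f IHf].
- rewrite rmorph1 -mpolyC1 mderivC big1 // => k _.
  by rewrite -mpolyC1 mderivC rmorph0 mul0r.
- rewrite [psum_subst _ _]rmorphD mderivD IHf IHg -big_split.
  by apply: eq_bigr => k _; rewrite mderivD rmorphD mulrDl.
- rewrite psum_substZ mderivZ IHf scaler_sumr; apply: eq_bigr => k _.
  by rewrite mderivZ psum_substZ scalerAl.
rewrite [psum_subst _ _]rmorphM mderivM IHf mulr_sumr.
have -> : (psum_subst (fun j : 'I_N => 'X_j) ('X_k : {mpoly C[K]}))^`M(i)
    = (d k)%:R *: 'X_i ^+ (d k).-1.
  rewrite psum_substX (linear_sum (mderiv i)) (bigD1 i) //= big1 ?addr0; last first.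
     by move=> j ne_ji; rewrite mpolyXn mderivX mulmnE mnm1E (negbTE ne_ji) scale0r.
  rewrite mpolyXn mderivX mulmnE mnm1E eqxx mul1n mpolyXn; congr (_ *: 'X_[_]).
  apply/mnmP => j; rewrite mnmBE !mulmnE !mnm1E.
  by case: (i == j); rewrite ?mul1n ?mul0n ?subn1.
rewrite [RHS](eq_bigr (fun l : 'I_K =>
   (k == l)%:R * psum_subst (fun j => 'X_j) f * ((d l)%:R *: 'X_i ^+ (d l).-1)
   + psum_subst (fun j : 'I_N => 'X_j) ('X_k : {mpoly C[K]})
     * (psum_subst (fun j => 'X_j) f^`M(l) * ((d l)%:R *: 'X_i ^+ (d l).-1)))).
  rewrite big_split /=; congr (_ + _).
  rewrite (bigD1 k) //= eqxx mul1r big1 ?addr0; first by rewrite mulrC.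
  by move=> l ne_lk; rewrite eq_sym (negbTE ne_lk) !mul0r.
move=> l _; rewrite mderivM mderivXU rmorphD mulrDl; congr (_ + _).
  by rewrite /= [psum_subst _ (_ * _)]rmorphM /= rmorph_nat.
by rewrite /= [psum_subst _ (_ * _)]rmorphM /= mulrA.
Qed.

Hypothesis d_gt0 : forall k, (0 < d k)%N.
Hypothesis d_inj : injective d.

(* Jacobian criterion: an algebraic relation of minimal degree has partial
   derivatives that are relations as well, by the Vandermonde argument. *)
Lemma psum_subst_eq0 N f : (forall k, d k <= N)%N ->
  psum_subst (fun j : 'I_N => 'X_j) f = 0 -> f = 0.
Proof.
move=> d_le; have [e] := ubnP (msize f); elim: e f => // e IHe f lt_fe f0.
have deriv0 k : f^`M(k) = 0.
  have [//|nz] := eqVneq f^`M(k) 0; apply: IHe.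
    rewrite -ltnS; apply: leq_ltn_trans lt_fe.
    rewrite -(mlead_deg nz); have := mlead_supp nz.
    rewrite mcoeff_msupp mcoeff_deriv mulrn_eq0 /= -mcoeff_msupp => /msize_mdeg_lt.
    by rewrite mdegD mdeg1 addn1.
  (* By the chain rule the [N] variables are roots of [p], whose degree is below [N] since all
     [d l <= N]; so [p = 0]. Injectivity of [d] then isolates each partial derivative as a
     coefficient. *)
  pose p : {poly {mpoly C[N]}} := \sum_l
    (psum_subst (fun j => 'X_j) f^`M(l) * (d l)%:R) *: 'X^((d l).-1).
  have p0 : p = 0.
    apply/eqP/negPn/negP => p_neq0.
    pose rs := [seq ('X_i : {mpoly C[N]}) | i : 'I_N].
    have Urs : uniq rs.
      rewrite map_inj_uniq ?enum_uniq // => i j /(congr1 (fun g => g@_U_(i))).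
      rewrite !mcoeffXU eqxx; case: eqP => // _ /eqP.
      by rewrite oner_eq0.
    have all_rs : all (root p) rs.
      apply/allP => _ /mapP[i _ ->]; apply/rootP.
      have := congr1 (mderiv i) f0; rewrite deriv_psum_subst mderiv0 => der0.
      rewrite horner_sum -[RHS]der0.
      apply: eq_bigr => l _; rewrite hornerZ hornerXn -mulrA; congr (_ * _).
      by rewrite -scaler_nat -scalerAl mul1r.
    have := max_poly_roots p_neq0 all_rs Urs.
    rewrite size_map size_enum_ord ltnNge => /negP; apply.
    rewrite (leq_trans (size_sum _ _ _)) //; apply/bigmax_leqP => l _.
    rewrite (leq_trans (size_scale_leq _ _)) // size_polyXn prednK ?d_gt0 //.
  have : p`_(d k).-1 = 0 by rewrite p0 coef0.
  rewrite coef_sum (bigD1 k) //= coefZ coefXn eqxx mulr1 big1 ?addr0; last first.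
    move=> l ne_lk; rewrite coefZ coefXn; case: eqP; rewrite ?mulr0 // => eq_d.
    case/eqP: ne_lk; apply: d_inj; have := d_gt0 l; have := d_gt0 k; lia.
  case E: (d k) (d_gt0 k) => [//|j] _.
  by rewrite mulr_natr => /mpoly_torsion_free.
have fC : f = (f@_0%MM)%:MP.
  apply/mpolyP => m; rewrite mcoeffC; case: (eqVneq m 0%MM) => [->|m_neq0].
    by rewrite mulr1.
  rewrite mulr0.
  have [k k_gt0] : exists k, (0 < m k)%N.
    apply/existsP; apply: contraT; rewrite negb_exists => /forallP m0.
    case/eqP: m_neq0; apply/mnmP => k; rewrite mnm0E.
    by apply/eqP; rewrite eqn0Ngt m0.
  have le_km : (U_(k) <= m)%MM by rewrite lep1mP -lt0n.
  have := congr1 (mcoeff (m - U_(k))%MM) (deriv0 k).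
  rewrite mcoeff_deriv mcoeff0 submK // => /eqP; rewrite mulrn_eq0 /=.
  by move/eqP.
move: f0; rewrite fC psum_substC => /eqP; rewrite mpolyC_eq0 => /eqP->.
exact: mpolyC0.
Qed.

End PowerSumSubstitution.

Section GenericPoint.
Variables (C : numFieldType) (N : nat).
Local Notation F := {fraction {mpoly C[N]}}.

Definition gen_pt (i : 'I_N) : F := tofrac ('X_i : {mpoly C[N]}).
Definition gen_cst : C -> F := @tofrac {mpoly C[N]} \o @mpolyC N C.
HB.instance Definition _ :=
  GRing.RMorphism.copy gen_cst (@tofrac {mpoly C[N]} \o @mpolyC N C).

Lemma gen_pt_inj : injective gen_pt.
Proof.
move=> i j /eqP; rewrite tofrac_eq.
move=> /eqP/(congr1 (fun g : {mpoly C[N]} => g@_U_(i))).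
by rewrite !mcoeffXU eqxx; case: eqP => // _ /eqP; rewrite oner_eq0.
Qed.

Lemma gen_pt_neq0 i : gen_pt i != 0.
Proof.
rewrite tofrac_eq0; apply/eqP => /(congr1 (fun g : {mpoly C[N]} => g@_U_(i))).
by rewrite mcoeffXU eqxx mcoeff0 => /eqP; rewrite oner_eq0.
Qed.

Lemma ev_gen_pt K (d : 'I_K -> nat) (f : {mpoly C[K]}) :
  ev gen_cst d gen_pt f = tofrac (psum_subst d (fun i : 'I_N => 'X_i) f).
Proof.
elim/mpoly_mulX_ind: f => [|f g IHf IHg|a f IHf|k f IHf].
- by rewrite !rmorph1.
- rewrite [LHS]rmorphD [psum_subst _ _ _]rmorphD [RHS]rmorphD.
  by congr (_ + _); [exact: IHf | exact: IHg].
- by rewrite evZ psum_substZ -mul_mpolyC [RHS]rmorphM; congr (_ * _); exact: IHf.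
rewrite [LHS]rmorphM [psum_subst _ _ _]rmorphM [RHS]rmorphM.
congr (_ * _); last exact: IHf.
rewrite /= evX psum_substX rmorph_sum; apply: eq_bigr => i _.
by rewrite /= rmorphXn.
Qed.

Lemma tofrac_alternant (e : 'I_N -> nat) :
  tofrac (alternant C e) = alt_det gen_pt e.
Proof.
rewrite /alternant -det_map_mx; congr (\det _); apply/matrixP => i j.
by rewrite !mxE /= rmorphXn.
Qed.

End GenericPoint.

Lemma alt_det_delta_neq0 (F : fieldType) N (x : 'I_N -> F) : injective x ->
  alt_det x (@delta N) != 0.
Proof.
elim: N x => [|N IHN] x x_inj; first by rewrite /alt_det det_mx00 oner_eq0.
rewrite (alt_det_delta_lift x ord0) mul1r mulf_neq0 //.
  by apply/prodf_neq0 => j ne_j; apply: sub_neq0.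
by apply: IHN; apply: inj_comp x_inj lift_inj.
Qed.

Section SchurFunctions.
Variables (C : numFieldType) (K : nat) (d : 'I_K -> nat) (D : nat).
Hypothesis d_gt0 : forall k, (0 < d k)%N.

(** The alternant identity shows that the vertex function satisfies the property from which [schur]
    is chosen; the Vandermonde determinant is nonzero, so the quotient is unique. *)
Lemma schur_vertex_fun N lam :
  (forall k, (k < D)%N -> ((2 - true)%:R : C) *+ #|[pred j | d j == k.+1]|
    = 1 - (1 - (2 - true)%:R) ^+ k.+1) ->
  (size lam <= N)%N -> all (leq 1) lam -> (sumn lam <= D)%N ->
  schur C N lam = psum_subst d (fun i => 'X_i) (vertex_fun C d true lam).
Proof.
move=> d_count le_N lam_gt0 le_D; rewrite /schur le_N.
set P := fun s : {mpoly C[N]} => _ = _.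
set s1 := psum_subst _ _ _.
have Ps1 : P s1.
  apply/eqP; rewrite -tofrac_eq; apply/eqP.
  rewrite rmorphM /= !tofrac_alternant -ev_gen_pt.
  rewrite -(alternant_vertex_fun (@gen_cst C N) d_gt0 d_count (@gen_pt_inj C N)
    (@gen_pt_neq0 C N) le_N lam_gt0 le_D).
  by [].
have := epsilon_spec (inhabits (0 : {mpoly C[N]})) P (ex_intro _ s1 Ps1).
rewrite {1}/P -Ps1; apply: mulIf.
rewrite -tofrac_eq0 tofrac_alternant.
exact: alt_det_delta_neq0 (@gen_pt_inj C N).
Qed.

Lemma schurQ_vertex_fun N mu :
  (forall k, (k < D)%N -> ((2 - false)%:R : C) *+ #|[pred j | d j == k.+1]|
    = 1 - (1 - (2 - false)%:R) ^+ k.+1) ->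
  (size mu <= N)%N -> admissible false mu -> (sumn mu <= D)%N ->
  schurQ C N mu
    = tofrac (psum_subst d (fun i => 'X_i) (vertex_fun C d false mu)).
Proof.
move=> d_count le_N adm le_D; rewrite /schurQ -ev_gen_pt.
rewrite -(HLQ_vertex_fun (@gen_cst C N) d_gt0 d_count (@gen_pt_inj C N)
    (@gen_pt_neq0 C N) le_N adm le_D).
by [].
Qed.

End SchurFunctions.

(** * Multiplicities and Glaisher's map *)

Local Open Scope nat_scope.

Section PartOfMult.
Variable m : nat -> nat.

Lemma part_of_multS b :
  part_of_mult b.+1 m = nseq (m b.+1) b.+1 ++ part_of_mult b m.
Proof. by rewrite /part_of_mult -[b.+1]addn1 iotaD rev_cat add1n addn1. Qed.

Lemma big_part_of_mult b (F : nat -> nat) :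
  \sum_(x <- part_of_mult b m) F x = \sum_(1 <= i < b.+1) m i * F i.
Proof.
elim: b => [|b IHb]; first by rewrite big_nil big_geq.
rewrite part_of_multS big_cat IHb [RHS]big_nat_recr //= [RHS]addnC; congr (_ + _).
by rewrite big_nseq iter_addn_0 mulnC.
Qed.

Lemma count_part_of_mult b i :
  count_mem i (part_of_mult b m) = if 0 < i <= b then m i else 0.
Proof.
rewrite -sum1_count big_mkcond big_part_of_mult /=.
rewrite (eq_bigr (fun k => if k == i then m k else 0)) => [|k _]; last first.
  by case: eqP; rewrite ?muln1 ?muln0.
by rewrite -big_mkcond big_nat1_eq ltnS.
Qed.

Lemma size_part_of_mult b :
  size (part_of_mult b m) = \sum_(1 <= i < b.+1) m i.
Proof.
by rewrite -sum1_size big_part_of_mult; apply: eq_bigr => i _; rewrite muln1.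
Qed.

Lemma sumn_part_of_mult b :
  sumn (part_of_mult b m) = \sum_(1 <= i < b.+1) m i * i.
Proof. by rewrite sumnE big_part_of_mult. Qed.

Lemma part_of_mult_gt0 b : all (leq 1) (part_of_mult b m).
Proof.
apply/allP => i; rewrite -has_pred1 has_count count_part_of_mult.
by case: ifP => // /andP[].
Qed.

Lemma mem_part_of_mult b i : i \in part_of_mult b m -> i <= b.
Proof.
by rewrite -has_pred1 has_count count_part_of_mult; case: ifP => // /andP[].
Qed.

Lemma sorted_part_of_mult b : sorted geq (part_of_mult b m).
Proof.
rewrite sorted_pairwise => [|y x z le_yx le_zy]; last exact: leq_trans le_zy le_yx.
elim: b => // b IHb; rewrite part_of_multS pairwise_cat IHb andbT.
apply/andP; split.
  apply/allrelP => x y; rewrite mem_nseq => /andP[_ /eqP->] /mem_part_of_mult.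
  exact: leqW.
elim: (m _) => //= k ->; rewrite andbT.
by apply/allP => x; rewrite mem_nseq => /andP[_ /eqP->] /=.
Qed.

End PartOfMult.

Lemma sorted_geq_eq s1 s2 : sorted geq s1 -> sorted geq s2 ->
  (forall i, count_mem i s1 = count_mem i s2) -> s1 = s2.
Proof.
move=> srt1 srt2 eq_count; apply: (sorted_eq _ _ srt1 srt2).
- by move=> y x z le_yx le_zy; apply: leq_trans le_zy le_yx.
- by move=> x y /anti_leq.
by apply/allP => i _; rewrite /= eq_count.
Qed.

Lemma sum_count (lam : seq nat) b (F : nat -> nat) : 0 \notin lam ->
  sumn lam <= b ->
  \sum_(x <- lam) F x = \sum_(1 <= i < b.+1) count_mem i lam * F i.
Proof.
elim: lam => [|a lam IHlam] /=; first by rewrite big_nil big1.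
rewrite inE negb_or eq_sym -lt0n => /andP[a_gt0 lam0] le_b.
rewrite big_cons IHlam //; last by lia.
under [RHS]eq_bigr do rewrite mulnDl.
rewrite big_split /=; congr (_ + _).
rewrite (eq_bigr (fun k => if k == a then F k else 0)) => [|k _]; last first.
  by rewrite eq_sym; case: eqP; rewrite ?mul1n ?mul0n.
by rewrite -big_mkcond big_nat1_eq a_gt0 ltnS (_ : a <= b) //; lia.
Qed.

Section Multiplicities.
Variable (lam : seq nat).
Hypothesis lam_gt0 : 0 \notin lam.

Lemma count_range i : ~~ (0 < i <= sumn lam) -> count_mem i lam = 0.
Proof.
apply: contraNeq; rewrite -lt0n -has_count has_pred1 => lam_i.
rewrite mem_leq_sumn // andbT lt0n; apply: contraNneq lam_gt0 => <-.
exact: lam_i.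
Qed.

Lemma count_rpart i : count_mem i (rpart lam) = odd (count_mem i lam).
Proof.
by rewrite count_part_of_mult; case: ifPn => // /count_range->.
Qed.

Lemma count_dpart i : count_mem i (dpart lam) = (count_mem i lam)./2.
Proof.
by rewrite count_part_of_mult; case: ifPn => // /count_range->.
Qed.

Lemma admissible_rpart : admissible false (rpart lam).
Proof.
rewrite /admissible part_of_mult_gt0 andbT.
have := sorted_part_of_mult (fun i => odd (count_mem i lam)) (sumn lam).
rewrite sorted_pairwise => [pw|y x z le_yx le_zy]; last exact: leq_trans le_zy le_yx.
have : uniq (rpart lam).
  apply: count_mem_uniq => i; rewrite -has_pred1 has_count count_rpart.
  by case: odd.
rewrite uniq_pairwise => Ur.
have : pairwise [rel a b | geq a b && (a != b)] (rpart lam).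
  by rewrite pairwise_relI pw.
by apply: sub_pairwise => a b /=; rewrite addn0 ltn_neqAle eq_sym andbC.
Qed.

Lemma admissible_dpart : admissible true (dpart lam).
Proof.
rewrite /admissible part_of_mult_gt0 andbT.
have := sorted_part_of_mult (fun i => (count_mem i lam)./2) (sumn lam).
rewrite sorted_pairwise => [pw|y x z le_yx le_zy]; last exact: leq_trans le_zy le_yx.
by apply: sub_pairwise pw => a b /=; rewrite addn1 ltnS.
Qed.

Lemma sumn_rpart_dpart : sumn (rpart lam) + 2 * sumn (dpart lam) = sumn lam.
Proof.
rewrite !sumn_part_of_mult big_distrr -big_split /=.
transitivity (\sum_(1 <= i < (sumn lam).+1) count_mem i lam * i).
  apply: eq_bigr => i _; rewrite -[X in _ = X * _]odd_double_half mulnDl.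
  by rewrite -muln2; lia.
by rewrite [RHS]sumnE (sum_count id lam_gt0 (leqnn _)).
Qed.

End Multiplicities.

Section TwoAdic.

Lemma logn_two_adic p j : logn 2 (2 ^ p * j.*2.+1) = p.
Proof.
rewrite lognM ?expn_gt0 // pfactorK // logn_coprime ?addn0 //.
by rewrite coprime2n /= odd_double.
Qed.

Lemma oddpart_two_adic p j : (2 ^ p * j.*2.+1)`_2^' = j.*2.+1.
Proof.
have := partnC 2 (_ : 0 < 2 ^ p * j.*2.+1).
rewrite muln_gt0 expn_gt0 /= p_part logn_two_adic => /(_ isT) /eqP.
by rewrite eqn_pmul2l ?expn_gt0 // => /eqP.
Qed.

Lemma two_adicE k : 0 < k -> 2 ^ logn 2 k * (k`_2^')./2.*2.+1 = k.
Proof.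
move=> k_gt0; have odd_k : odd k`_2^' by rewrite odd_2'nat part_pnat.
rewrite -[RHS](partnC 2 k_gt0) p_part; congr (_ * _).
by rewrite -[RHS]odd_double_half odd_k.
Qed.

(** Every positive [k] is [2 ^ p * j.*2.+1] for exactly one pair. The index box also contains
    products above [n], which the vanishing of [G] discards. *)
Lemma sum_two_adic (G : nat -> nat) n : (forall k, n < k -> G k = 0) ->
  \sum_(j < n) \sum_(p < n.+1) G (2 ^ p * j.*2.+1)
    = \sum_(1 <= k < n.+1) G k.
Proof.
move=> G0.
transitivity (\sum_(j < n) \sum_(p < n.+1) \sum_(1 <= k < n.+1)
    if k == 2 ^ p * j.*2.+1 then G k else 0).
  apply: eq_bigr => j _; apply: eq_bigr => p _.
  rewrite -big_mkcond big_nat1_eq muln_gt0 expn_gt0 /= ltnS.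
  by case: leqP => // /G0.
transitivity (\sum_(1 <= k < n.+1) \sum_(j < n) \sum_(p < n.+1)
    if k == 2 ^ p * j.*2.+1 then G k else 0).
  by rewrite [RHS]exchange_big; apply: eq_bigr => j _; rewrite [RHS]exchange_big.
apply: eq_big_nat => k /andP[k_gt0]; rewrite ltnS => le_kn.
rewrite /=.
have k_neq0 : k != 0 by rewrite -lt0n.
have lt_j : (k`_2^')./2 < n.
  have := two_adicE k_gt0; have := expn_gt0 2 (logn 2 k); nia.
have lt_p : logn 2 k < n.+1.
  by rewrite ltnS (leq_trans _ le_kn) // ltnW // ltn_logl.
rewrite (bigD1 (Ordinal lt_j)) //= (bigD1 (Ordinal lt_p)) //= two_adicE // eqxx.
rewrite !big1 ?addn0 // => [j ne_j|p ne_p].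
  rewrite big1 // => p _; case: eqP => // eq_k; case/eqP: ne_j.
  by apply: val_inj; rewrite /= eq_k oddpart_two_adic /= uphalf_double.
case: eqP => // eq_k; case/eqP: ne_p.
by apply: val_inj; rewrite /= eq_k logn_two_adic.
Qed.

Lemma odd_bit_sum L (e : nat -> bool) p : p < L ->
  odd ((\sum_(i < L) e i * 2 ^ i) %/ 2 ^ p) = e p.
Proof.
elim: L e p => // L IHL e p lt_pL.
have -> : \sum_(i < L.+1) e i * 2 ^ i
    = e 0 + (\sum_(i < L) e i.+1 * 2 ^ i).*2.
  rewrite big_ord_recl expn0 muln1 -muln2 big_distrl /=; congr (_ + _).
  by apply: eq_bigr => i _; rewrite expnS mulnCA mulnC.
case: p lt_pL => [|p] lt_pL; first by rewrite divn1 oddD odd_double addbF oddb.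
by rewrite expnS divnMA divn2 half_bit_double (IHL (fun i => e i.+1)).
Qed.

Lemma bit_sum L a : a < 2 ^ L -> \sum_(i < L) odd (a %/ 2 ^ i) * 2 ^ i = a.
Proof.
elim: L a => [|L IHL] a lt_a.
  by rewrite big_ord0; move: lt_a; rewrite expn0 ltnS leqn0 => /eqP.
rewrite big_ord_recl expn0 divn1 muln1 -[RHS](odd_double_half a); congr (_ + _).
rewrite -[in RHS](IHL a./2); last by move: lt_a; rewrite expnS; lia.
rewrite -muln2 big_distrl /=; apply: eq_bigr => i _.
by rewrite expnS divnMA divn2; lia.
Qed.

End TwoAdic.

Section Multinomials.
Variable n : nat.

Definition deg_odd (j : 'I_n) : nat := j.*2.+1.
Definition deg_all (j : 'I_n) : nat := j.+1.

(** The multiplicities of the Glaisher image of [rpart lam], indexed by the odd part [j.*2.+1]. The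
    binary digits of an entry tell which [2 ^ p * j.*2.+1] have odd multiplicity in [lam]. *)
Definition oddmult (lam : seq nat) : 'X_{1..n} :=
  [multinom \sum_(p < n.+1) odd (count_mem (2 ^ p * j.*2.+1) lam) * 2 ^ p
    | j < n].

Definition halfmult (lam : seq nat) : 'X_{1..n} :=
  [multinom (count_mem j.+1 lam)./2 | j < n].

Section Partition.
Variable (lam : seq nat).
Hypotheses (lam_gt0 : 0 \notin lam) (lam_n : sumn lam = n).

Lemma count_large k : n < k -> count_mem k lam = 0.
Proof. by move=> lt_nk; rewrite count_range // lam_n [k <= n]leqNgt lt_nk andbF. Qed.

Lemma weight_oddmult : weight deg_odd (oddmult lam) = sumn (rpart lam).
Proof.
rewrite sumn_part_of_mult lam_n -(@sum_two_adic (fun k => odd (count_mem k lam) * k)).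
  apply: eq_bigr => j _; rewrite mnmE big_distrl /=.
  by apply: eq_bigr => p _; rewrite mulnA.
by move=> k /count_large->.
Qed.

Lemma weight_halfmult : weight deg_all (halfmult lam) = sumn (dpart lam).
Proof.
rewrite sumn_part_of_mult lam_n big_add1 big_mkord.
by apply: eq_bigr => j _; rewrite mnmE.
Qed.

Lemma mdeg_halfmult : mdeg (halfmult lam) = size (dpart lam).
Proof.
rewrite mdegE size_part_of_mult lam_n big_add1 big_mkord.
by apply: eq_bigr => j _; rewrite mnmE.
Qed.

Lemma mdeg_oddmult : mdeg (oddmult lam) = size (glaisher (rpart lam)).
Proof.
rewrite size_part_of_mult.
transitivity (\sum_(k <- rpart lam) 2 ^ logn 2 k).
  rewrite mdegE big_part_of_mult lam_n.
  rewrite -(@sum_two_adic (fun k => odd (count_mem k lam) * 2 ^ logn 2 k)).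
    apply: eq_bigr => j _; rewrite mnmE.
    by apply: eq_bigr => p _; rewrite logn_two_adic.
  by move=> k /count_large->.
rewrite [RHS](eq_bigr (fun i => \sum_(k <- rpart lam)
    if k`_2^' == i then 2 ^ logn 2 k else 0)) => [|i _]; last by rewrite big_mkcond.
rewrite [RHS]exchange_big big_seq [RHS]big_seq /=; apply: eq_bigr => k k_in.
rewrite [RHS](eq_bigr (fun i => if i == k`_2^' then 2 ^ logn 2 k else 0)) => [|i _].
  rewrite -big_mkcond big_nat1_eq part_gt0 ltnS ifT //.
  apply: leq_trans (mem_leq_sumn k_in).
  have k_gt0 : 0 < k := allP (part_of_mult_gt0 _ _) _ k_in.
  by rewrite dvdn_leq // dvdn_part.
by rewrite eq_sym.
Qed.

End Partition.

(** A multiplicity is determined by its half, read from [halfmult], and its parity, a binary digit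
    of an entry of [oddmult]. *)
Lemma oddmult_halfmult_inj lam mu :
  0 \notin lam -> 0 \notin mu -> sorted geq lam -> sorted geq mu ->
  sumn lam = n -> sumn mu = n ->
  oddmult lam = oddmult mu -> halfmult lam = halfmult mu -> lam = mu.
Proof.
move=> lam0 mu0 srt_lam srt_mu lam_n mu_n eq_odd eq_half.
apply: sorted_geq_eq => // i.
have [i_range|i_range] := boolP (0 < i <= n); last first.
  by rewrite !count_range ?lam_n ?mu_n.
have [i_gt0 le_in] := andP i_range.
rewrite -[LHS]odd_double_half -[RHS]odd_double_half.
have lt_i : i.-1 < n by rewrite prednK.
have /mnmP/(_ (Ordinal lt_i)) := eq_half; rewrite !mnmE /= prednK // => ->.
congr (nat_of_bool _ + _).
have lt_j : (i`_2^')./2 < n.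
  have := two_adicE i_gt0; have := expn_gt0 2 (logn 2 i); nia.
have lt_p : logn 2 i < n.+1.
  by rewrite ltnS (leq_trans _ le_in) // ltnW // ltn_logl.
have /mnmP/(_ (Ordinal lt_j)) := eq_odd; rewrite !mnmE /=.
move/(congr1 (fun a => odd (a %/ 2 ^ logn 2 i))).
rewrite (odd_bit_sum (fun p => odd (count_mem (2 ^ p * _) lam))) //.
rewrite (odd_bit_sum (fun p => odd (count_mem (2 ^ p * _) mu))) //.
by rewrite two_adicE.
Qed.

Lemma oddmult_halfmult_surj (a b : 'X_{1..n}) :
  weight deg_odd a + 2 * weight deg_all b = n ->
  exists lam : intpartn n, oddmult lam = a /\ halfmult lam = b.
Proof.
(* The multiplicity of [k = 2^p q] takes its parity from the [p]-th binary digit of the exponent of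
   [a] belonging to [q], and its half from [b]. *)
move=> ab_n; pose bit k := odd (nth 0 a (k`_2^')./2 %/ 2 ^ logn 2 k).
pose mult k := bit k + (nth 0 b k.-1).*2.
pose lam := part_of_mult n mult.
have bitE p (j : 'I_n) : bit (2 ^ p * j.*2.+1) = odd (a j %/ 2 ^ p).
  by rewrite /bit logn_two_adic oddpart_two_adic /= uphalf_double -mnm_nth.
(* Restricting to parts at most [n] loses no digit: the entry [a j] times [2j + 1] is at most [n],
   so [2^p (2j + 1) > n] forces [a j < 2^p]. *)
have bit_large p (j : 'I_n) :
    n < 2 ^ p * j.*2.+1 -> bit (2 ^ p * j.*2.+1) = false.
  move=> lt_n; rewrite bitE divn_small //.
  have : a j * j.*2.+1 <= n.
    by rewrite -[X in _ <= X]ab_n /weight (bigD1 j) //= -addnA leq_addr.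
  move=> le_n; rewrite -(@ltn_pmul2r j.*2.+1) //.
  exact: leq_ltn_trans le_n lt_n.
have a_bits (j : 'I_n) : \sum_(p < n.+1) bit (2 ^ p * j.*2.+1) * 2 ^ p = a j.
  under eq_bigr do rewrite bitE.
  apply: bit_sum; apply: (@leq_ltn_trans n); last exact/ltnW/ltn_expl.
  rewrite -[X in _ <= X]ab_n /weight (bigD1 j) //= -addnA.
  by rewrite (leq_trans (leq_pmulr _ _) (leq_addr _ _)).
have lam_count k : count_mem k lam = if 0 < k <= n then mult k else 0.
  exact: count_part_of_mult.
have lam_sum : sumn lam = n.
  rewrite sumn_part_of_mult -[RHS]ab_n.
  rewrite (eq_bigr (fun k => bit k * k + 2 * (nth 0 b k.-1 * k))) => [|k _].
    rewrite big_split -big_distrr /=; congr (_ + 2 * _); last first.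
      by rewrite big_add1 big_mkord; apply: eq_bigr => j _; rewrite -mnm_nth.
    rewrite (eq_big_nat _ _ (F2 := fun k => if k <= n then bit k * k else 0)).
      rewrite -sum_two_adic => [|k]; last by rewrite ltnNge => /negbTE->.
      apply: eq_bigr => j _; rewrite -a_bits big_distrl /=.
      apply: eq_bigr => p _; rewrite -mulnA; case: leqP => // /bit_large->.
      by rewrite mul0n.
    by move=> k /andP[_]; rewrite ltnS => ->.
  by rewrite /mult -mul2n mulnDl mulnA.
have lam_ok : is_intpartn n lam.
  rewrite /is_intpartn sorted_part_of_mult lam_sum eqxx andbT /=.
  by apply/negP => /(allP (part_of_mult_gt0 mult n)).
exists (IntPartn lam_ok); split; apply/mnmP => j; rewrite mnmE /=.
  rewrite -[RHS]a_bits; apply: eq_bigr => p _; congr (nat_of_bool _ * _).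
  rewrite lam_count muln_gt0 expn_gt0 /=; case: leqP => [_|/bit_large-> //].
  by rewrite oddD odd_double addbF oddb.
by rewrite lam_count /= ltn_ord half_bit_double -mnm_nth.
Qed.

End Multinomials.

Local Open Scope ring_scope.

(** * Odd and even power sums *)

Section Join.
Variables (C : numFieldType) (n : nat).
Implicit Types (a b : 'X_{1..n}) (f g : {mpoly C[n]}).

Definition mjoin a b : 'X_{1..n + n} :=
  [multinom match split i with inl j => a j | inr j => b j end | i < n + n].

(** Each degree from 1 to [2n] occurs once: odd degrees on the left for the Q-factor, even ones on
    the right for the Schur factor in [x^2]. *)
Definition deg_join (i : 'I_(n + n)) : nat :=
  match split i with inl j => j.*2.+1 | inr j => j.+1.*2 end.

Lemma split_lshift j : split (lshift n j : 'I_(n + n)) = inl j.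
Proof. by rewrite -(unsplitK (inl j)). Qed.

Lemma split_rshift j : split (rshift n j : 'I_(n + n)) = inr j.
Proof. by rewrite -(unsplitK (inr j)). Qed.

Lemma mjoinl a b j : mjoin a b (lshift n j) = a j.
Proof. by rewrite mnmE split_lshift. Qed.

Lemma mjoinr a b j : mjoin a b (rshift n j) = b j.
Proof. by rewrite mnmE split_rshift. Qed.

Lemma deg_joinl j : deg_join (lshift n j) = j.*2.+1.
Proof. by rewrite /deg_join split_lshift. Qed.

Lemma deg_joinr j : deg_join (rshift n j) = j.+1.*2.
Proof. by rewrite /deg_join split_rshift. Qed.

Lemma deg_join_gt0 i : (0 < deg_join i)%N.
Proof. by rewrite /deg_join; case: split. Qed.

Lemma deg_join_leq i : (deg_join i <= n + n)%N.
Proof. by rewrite /deg_join; case: split => j; have := ltn_ord j; lia. Qed.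

Lemma deg_join_inj : injective deg_join.
Proof.
move=> i j; rewrite -{2}[i]splitK -{2}[j]splitK /deg_join.
case: (split i) => i'; case: (split j) => j' /=; last 1 first.
- by move=> eq_ij; congr (rshift _ _); apply: val_inj => /=; lia.
- by move=> eq_ij; congr (lshift _ _); apply: val_inj => /=; lia.
- by move=> eq_ij; exfalso; lia.
by move=> eq_ij; exfalso; lia.
Qed.

Lemma mjoin_eq a b a' b' :
  (mjoin a b == mjoin a' b') = (a == a') && (b == b').
Proof.
apply/eqP/andP => [eq_ab|[/eqP-> /eqP->] //].
by split; apply/eqP/mnmP => j;
  [rewrite -(mjoinl a b) eq_ab mjoinl | rewrite -(mjoinr a b) eq_ab mjoinr].
Qed.

Lemma mjoin_surj (m : 'X_{1..n + n}) :
  m = mjoin [multinom m (lshift n j) | j < n] [multinom m (rshift n j) | j < n].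
Proof.
apply/mnmP => i; rewrite -[i]splitK.
by case: (split i) => j /=; rewrite ?mjoinl ?mjoinr mnmE.
Qed.

Lemma weight_mjoin a b : weight deg_join (mjoin a b)
  = (weight (@deg_odd n) a + 2 * weight (@deg_all n) b)%N.
Proof.
rewrite /weight big_split_ord big_distrr /=; congr (_ + _)%N.
  by apply: eq_bigr => j _; rewrite mjoinl deg_joinl.
by apply: eq_bigr => j _; rewrite mjoinr deg_joinr mulnCA -mul2n.
Qed.

Lemma mdeg_mjoin a b : mdeg (mjoin a b) = (mdeg a + mdeg b)%N.
Proof.
rewrite !mdegE big_split_ord /=; congr (_ + _)%N.
  by apply: eq_bigr => j _; rewrite mjoinl.
by apply: eq_bigr => j _; rewrite mjoinr.
Qed.

(** A right variable has degree [2 (j + 1)], and dividing by [c = 2] leaves the weight [j + 1] of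
    the form <,>_1. *)
Lemma ipw_mjoin a b : ipw deg_join (2%:R : C) (mjoin a b)
  = ipw (@deg_odd n) 2%:R a * ipw (@deg_all n) 1 b.
Proof.
rewrite /ipw big_split_ord /=; congr (_ * _).
  by apply: eq_bigr => j _; rewrite mjoinl deg_joinl.
apply: eq_bigr => j _; rewrite mjoinr deg_joinr -muln2 natrM mulfK ?pnatr_eq0 //.
by rewrite divr1.
Qed.

(** Represents [f(x) g(x^2)]: squaring the letters turns [p_k] into [p_2k], a right variable. *)
Definition pjoin f g : {mpoly C[n + n]} :=
  mmap (@mpolyC (n + n) C) (fun j => 'X_(lshift n j)) f
  * mmap (@mpolyC (n + n) C) (fun j => 'X_(rshift n j)) g.

Lemma mcoeff_pjoin f g a b : (pjoin f g)@_(mjoin a b) = f@_a * g@_b.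
Proof.
have mmap1l a' : mmap1 (fun j => 'X_(lshift n j) : {mpoly C[n + n]}) a'
    = 'X_[mjoin a' 0%MM].
  rewrite mpolyXE_id /mmap1 big_split_ord /= [X in _ * X]big1 ?mulr1.
    by apply: eq_bigr => j _; rewrite mjoinl.
  by move=> j _; rewrite mjoinr mnm0E expr0.
have mmap1r b' : mmap1 (fun j => 'X_(rshift n j) : {mpoly C[n + n]}) b'
    = 'X_[mjoin 0%MM b'].
  rewrite mpolyXE_id /mmap1 big_split_ord /= [X in X * _]big1 ?mul1r.
    by apply: eq_bigr => j _; rewrite mjoinr.
  by move=> j _; rewrite mjoinl mnm0E expr0.
have mjoin0 a' b' : (mjoin a' 0 + mjoin 0 b')%MM = mjoin a' b'.
  apply/mnmP => i; rewrite -[i]splitK mnmDE.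
  by case: (split i) => j /=; rewrite ?mjoinl ?mjoinr mnm0E ?addn0.
have coefE h (m : 'X_{1..n}) : \sum_(k <- msupp h) h@_k * (k == m)%:R = h@_m :> C.
  rewrite [h in RHS]mpolyE raddf_sum; apply: eq_bigr => k _ /=.
  by rewrite mcoeffZ mcoeffX.
rewrite -[f@_a]coefE -[g@_b]coefE mulr_suml /pjoin /mmap mulr_suml.
rewrite raddf_sum; apply: eq_bigr => a' _ /=.
rewrite !mulr_sumr raddf_sum; apply: eq_bigr => b' _ /=.
rewrite mmap1l mmap1r mulrACA -mpolyXD mjoin0 -mpolyCM mcoeffCM mcoeffX mjoin_eq.
by rewrite mulrACA -natrM mulnb.
Qed.

Lemma psum_subst_pjoin N f g :
  psum_subst deg_join (fun i : 'I_N => 'X_i) (pjoin f g)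
    = psum_subst (@deg_odd n) (fun i => 'X_i) f
      * psum_subst (@deg_all n) (fun i : 'I_N => 'X_i ^+ 2) g.
Proof.
rewrite /pjoin [LHS]rmorphM /=; congr (_ * _).
  elim/mpoly_mulX_ind: f => [|f f' IHf IHf'|x f IHf|k f IHf].
  - by rewrite !rmorph1.
  - rewrite mmapD [LHS]rmorphD [RHS]rmorphD.
    by congr (_ + _); [exact: IHf | exact: IHf'].
  - by rewrite mmapZ mul_mpolyC !psum_substZ; congr (_ *: _); exact: IHf.
  rewrite [mmap _ _ _]rmorphM [LHS]rmorphM [RHS]rmorphM.
  congr (_ * _); last exact: IHf.
  by rewrite /= mmapX mmap1U !psum_substX; apply: eq_bigr => i _; rewrite deg_joinl.
elim/mpoly_mulX_ind: g {f} => [|f f' IHf IHf'|x f IHf|k f IHf].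
- by rewrite !rmorph1.
- rewrite mmapD [LHS]rmorphD [RHS]rmorphD.
  by congr (_ + _); [exact: IHf | exact: IHf'].
- by rewrite mmapZ mul_mpolyC !psum_substZ; congr (_ *: _); exact: IHf.
rewrite [mmap _ _ _]rmorphM [LHS]rmorphM [RHS]rmorphM.
congr (_ * _); last exact: IHf.
rewrite /= mmapX mmap1U !psum_substX; apply: eq_bigr => i _.
by rewrite deg_joinr -exprM mul2n.
Qed.

End Join.

Section Dilation.
Variables (C : numFieldType) (K : nat).
Implicit Type f : {mpoly C[K]}.

(** Doubling the power sums corresponds to repeating the alphabet, [x] to [(x, x)]. *)
Definition dilate f : {mpoly C[K]} :=
  mmap (@mpolyC K C) (fun k => 2%:R *: 'X_k) f.

Lemma mcoeff_dilate f m : (dilate f)@_m = 2 ^+ mdeg m * f@_m.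
Proof.
rewrite /dilate [f in RHS]mpolyE !raddf_sum mulr_sumr; apply: eq_bigr => k _ /=.
rewrite mcoeffCM mcoeffZ mcoeffX mulrCA; congr (_ * _).
have -> : mmap1 (fun j => 2%:R *: 'X_j) k = 2 ^+ mdeg k *: 'X_[k] :> {mpoly C[K]}.
  rewrite mpolyXE_id /mmap1; under eq_bigr do rewrite exprZn.
  by rewrite scaler_prod prodrXr mdegE.
by rewrite mcoeffZ mcoeffX; case: eqP => [->|_]; rewrite ?mulr0.
Qed.

Lemma psum_subst_dilate (d : 'I_K -> nat) N f :
  psum_subst d (tnth [tuple of [tuple 'X_i | i < N] ++ [tuple 'X_i | i < N]]) f
    = psum_subst d (fun i : 'I_N => 'X_i : {mpoly C[N]}) (dilate f).
Proof.
elim/mpoly_mulX_ind: f => [|f g IHf IHg|a f IHf|k f IHf].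
- by rewrite /dilate !rmorph1.
- rewrite /dilate mmapD [LHS]rmorphD [RHS]rmorphD.
  by congr (_ + _); [exact: IHf | exact: IHg].
- by rewrite /dilate mmapZ mul_mpolyC !psum_substZ; congr (_ *: _); exact: IHf.
rewrite /dilate [mmap _ _ _]rmorphM [LHS]rmorphM [RHS]rmorphM.
congr (_ * _); last exact: IHf.
rewrite /= mmapX mmap1U psum_substZ !psum_substX big_split_ord /=.
rewrite scaler_nat mulr2n; congr (_ + _); apply: eq_bigr => i _.
  by rewrite tnth_lshift tnth_mktuple.
by rewrite tnth_rshift tnth_mktuple.
Qed.

Lemma ipw_scale (d : 'I_K -> nat) (c : C) m : c != 0 ->
  ipw d c m * c ^+ mdeg m = ipw d 1 m.
Proof.
move=> c_neq0; rewrite mdegE -prodrXr -big_split; apply: eq_bigr => k _ /=.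
by rewrite mulrAC -exprMn divfK // divr1.
Qed.

End Dilation.

Section DegreeCounts.
Variables (C : numFieldType) (n : nat).

Lemma count_deg_odd k : (k < n)%N ->
  ((2 - false)%:R : C) *+ #|[pred j | @deg_odd n j == k.+1]|
    = 1 - (1 - (2 - false)%:R) ^+ k.+1.
Proof.
move=> lt_kn; have -> : 1 - (2 - false)%:R = -1 :> C.
  by rewrite (_ : (2 - false)%N = 2%N) //; ring.
have [odd_k|even_k] := boolP (odd k).
  rewrite eq_card0 ?mulr0n => [|j]; last by rewrite !inE /deg_odd; lia.
  by rewrite -signr_odd /= odd_k /= expr0 subrr.
have lt_j : (k./2 < n)%N by lia.
rewrite (eq_card1 (x := Ordinal lt_j)) => [|j].
  by rewrite -signr_odd /= even_k expr1 opprK.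
by rewrite !inE -val_eqE /deg_odd /=; lia.
Qed.

Lemma count_deg_all k : (k < n)%N ->
  ((2 - true)%:R : C) *+ #|[pred j | @deg_all n j == k.+1]|
    = 1 - (1 - (2 - true)%:R) ^+ k.+1.
Proof.
move=> lt_kn; rewrite (eq_card1 (x := Ordinal lt_kn)) => [|j].
  by rewrite subrr expr0n subr0.
by rewrite !inE.
Qed.

Lemma count_deg_join k : (k < n)%N ->
  ((2 - true)%:R : C) *+ #|[pred j | @deg_join n j == k.+1]|
    = 1 - (1 - (2 - true)%:R) ^+ k.+1.
Proof.
move=> lt_kn; have lt_j : (k./2 < n)%N by lia.
pose i0 : 'I_(n + n) := if odd k then rshift n (Ordinal lt_j)
                        else lshift n (Ordinal lt_j).
have deg_i0 : deg_join i0 = k.+1.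
  rewrite /i0; case: ifP => odd_k; rewrite ?deg_joinl ?deg_joinr /=; lia.
rewrite (eq_card1 (x := i0)) => [|j]; first by rewrite subrr expr0n subr0.
by rewrite !inE -deg_i0 (inj_eq (@deg_join_inj n)).
Qed.

End DegreeCounts.

(** Turns sums over partitions into sums over the support of a polynomial, hence into values of
    [ip]. *)
Lemma big_inj_support (V : nmodType) (I : finType) (J : eqType) (h : I -> J)
    (s : seq J) (G : J -> V) : injective h -> uniq s ->
  (forall x, x \in s -> exists i, h i = x) -> (forall x, x \notin s -> G x = 0) ->
  \sum_i G (h i) = \sum_(x <- s) G x.
Proof.
move=> h_inj Us s_h G0; rewrite -(big_map h xpredT) (bigID (mem s)) /=.
rewrite [X in _ + X]big1 ?addr0 // -big_filter; apply: perm_big.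
apply: uniq_perm => //.
  by rewrite filter_uniq // map_inj_uniq // index_enum_uniq.
move=> x; rewrite mem_filter; case: (boolP (x \in s)) => //= /s_h[i <-].
by apply: map_f; rewrite mem_index_enum.
Qed.

Section SubMatrix.
Variables (C : numClosedFieldType) (T : finType) (P : {set T}).

Lemma submx_on_mul (X Y : 'M[C]_#|T|) :
  (forall x y, x \in P -> y \notin P -> X (enum_rank x) (enum_rank y) = 0) ->
  submx_on P (X *m Y) = submx_on P X *m submx_on P Y.
Proof.
move=> X0; apply/matrixP => i j; rewrite !mxE.
rewrite (reindex (@enum_rank T)) /=; last exact/onW_bij/enum_rank_bij.
rewrite (bigID (mem P)) /= [X in _ + X]big1 ?addr0 => [|y nPy].
  by rewrite big_enum_val; apply: eq_bigr => k _; rewrite !mxE.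
by rewrite X0 ?mul0r // enum_valP.
Qed.

Lemma submx_on1 : submx_on P 1%:M = 1%:M :> 'M[C]_#|P|.
Proof.
apply/matrixP => i j; rewrite !mxE (inj_eq enum_rank_inj).
by rewrite (inj_eq enum_val_inj).
Qed.

End SubMatrix.

(** * The block determinant *)

Section MixedExpansion.
Variables (C : numClosedFieldType) (n : nat).
Local Notation T := (intpartn n).
Implicit Types (lam mu : T).
Local Notation c1 := ((2 - true)%:R : C).
Local Notation c2 := ((2 - false)%:R : C).

Definition rho lam : 'X_{1..n + n} := mjoin (oddmult n lam) (halfmult n lam).

Lemma intpartnP lam :
  [/\ sorted geq (parts lam), 0%N \notin parts lam & sumn (parts lam) = n].
Proof. by case/and3P: (valP lam) => /= ? ? /eqP. Qed.

Lemma intpartn_gt0 lam : all (leq 1) lam.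
Proof.
case: (intpartnP lam) => _ lam0 _; apply/allP => i lam_i.
by rewrite lt0n; apply: contraNneq lam0 => <-.
Qed.

Lemma admissible_intpartn lam : admissible true lam.
Proof.
rewrite /admissible intpartn_gt0 andbT; case: (intpartnP lam) => srt _ _.
move: srt; rewrite sorted_pairwise => [pw|y x z le_yx le_zy].
  by apply: sub_pairwise pw => a b /=; rewrite addn1 ltnS.
exact: leq_trans le_zy le_yx.
Qed.

Lemma sumn_rdpart lam : (sumn (rpart lam) + 2 * sumn (dpart lam) = n)%N.
Proof. by case: (intpartnP lam) => _ lam0 lam_n; rewrite sumn_rpart_dpart. Qed.

Lemma sumn_rpart_leq lam : (sumn (rpart lam) <= n)%N.
Proof. by rewrite -[X in (_ <= X)%N](sumn_rdpart lam) leq_addr. Qed.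

Lemma sumn_dpart_leq lam : (sumn (dpart lam) <= n)%N.
Proof.
by have := sumn_rdpart lam; lia.
Qed.

Lemma size_leq_sumn s : all (leq 1) s -> (size s <= sumn s)%N.
Proof. by move=> s_gt0; apply/leq_size_sumn/negP => /(allP s_gt0). Qed.

Lemma rho_inj : injective rho.
Proof.
move=> lam mu /eqP; rewrite mjoin_eq => /andP[/eqP eq_odd /eqP eq_half].
case: (intpartnP lam) (intpartnP mu) => srt lam0 lam_n [srt' mu0 mu_n].
by apply/val_inj/(oddmult_halfmult_inj (n := n)).
Qed.

Lemma rho_surj (m : 'X_{1..n + n}) : weight (@deg_join n) m = n ->
  exists lam, rho lam = m.
Proof.
rewrite [m]mjoin_surj weight_mjoin => /oddmult_halfmult_surj[lam [ea eb]].
by exists lam; rewrite /rho ea eb.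
Qed.

Local Notation fo := (vertex_fun C (@deg_odd n) false).
Local Notation fa := (vertex_fun C (@deg_all n) true).
Local Notation fj := (vertex_fun C (@deg_join n) true).

Definition mixed_coef mu lam : C :=
  (fo (rpart mu))@_(oddmult n lam) * (fa (dpart mu))@_(halfmult n lam).

Definition mixed_fun mu : {mpoly C[n + n]} :=
  pjoin (fo (rpart mu)) (fa (dpart mu)).

Lemma mcoeff_mixed_fun mu lam : (mixed_fun mu)@_(rho lam) = mixed_coef mu lam.
Proof. exact: mcoeff_pjoin. Qed.

Lemma deg_odd_gt0 (j : 'I_n) : (0 < deg_odd j)%N. Proof. by []. Qed.
Lemma deg_all_gt0 (j : 'I_n) : (0 < deg_all j)%N. Proof. by []. Qed.

Lemma eq_rdpart lam mu :
  rpart lam = rpart mu -> dpart lam = dpart mu -> lam = mu.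
Proof.
move=> eq_r eq_d; case: (intpartnP lam) (intpartnP mu) => srt lam0 _ [srt' mu0 _].
apply/val_inj/sorted_geq_eq => // i.
rewrite -[LHS]odd_double_half -[RHS]odd_double_half.
by rewrite -!count_rpart // -!count_dpart // eq_r eq_d.
Qed.

Lemma homog_pair_mem mu (a b : 'X_{1..n}) :
  a \in msupp (fo (rpart mu)) -> b \in msupp (fa (dpart mu)) ->
  exists lam, (oddmult n lam, halfmult n lam) = (a, b).
Proof.
have /dhomogP hom_o := homog_vertex_fun C false deg_odd_gt0 (rpart mu).
have /dhomogP hom_a := homog_vertex_fun C true deg_all_gt0 (dpart mu).
move=> /hom_o wt_a /hom_a wt_b.
have [|lam [<- <-]] := @oddmult_halfmult_surj n a b; last by exists lam.
by rewrite -[RHS](sumn_rdpart mu); congr (_ + 2 * _)%N.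
Qed.

(** Partitions correspond to pairs of monomials, and by [ipw_mjoin] the sum factors into the <,>_2
    product of the Q-parts and the <,>_1 product of the Schur parts. *)
Lemma mixed_coef_orthogonal mu mu' :
  \sum_lam mixed_coef mu lam * mixed_coef mu' lam * ipw (@deg_join n) c2 (rho lam)
    = if mu == mu' then 2 ^+ size (rpart mu) else 0.
Proof.
case: (intpartnP mu) (intpartnP mu') => _ mu0 _ [_ mu'0 _].
pose G (x : 'X_{1..n} * 'X_{1..n}) :=
  ((fo (rpart mu))@_x.1 * (fo (rpart mu'))@_x.1 * ipw (@deg_odd n) c2 x.1)
  * ((fa (dpart mu))@_x.2 * (fa (dpart mu'))@_x.2 * ipw (@deg_all n) c1 x.2).
transitivity (\sum_(lam : T) G (oddmult n lam, halfmult n lam)).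
  by apply: eq_bigr => lam _; rewrite /G /mixed_coef /= ipw_mjoin; ring.
rewrite (@big_inj_support _ _ _ (fun lam : T => (oddmult n lam, halfmult n lam))
  (allpairs pair (msupp (fo (rpart mu))) (msupp (fa (dpart mu)))) G).
- rewrite big_allpairs /= /G /=.
  under eq_bigr do rewrite -mulr_sumr.
  rewrite -mulr_suml -/(ip _ _ _ _) -/(ip _ _ _ _).
  rewrite (vertex_fun_orthogonal (D := n) deg_odd_gt0 (@count_deg_odd C n))
    ?sumn_rpart_leq ?admissible_rpart //.
  rewrite (vertex_fun_orthogonal (D := n) deg_all_gt0 (@count_deg_all C n))
    ?sumn_dpart_leq ?admissible_dpart //.
  have [->|ne_mu] := eqVneq mu mu'; first by rewrite !eqxx expr1n mulr1.
  case: eqP => [eq_r|]; last by rewrite mul0r.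
  case: eqP => [eq_d|]; last by rewrite mulr0.
  by case/eqP: ne_mu; apply: eq_rdpart.
- move=> lam lam' eq_ab; apply: rho_inj.
  have /= eq_a := congr1 fst eq_ab; have /= eq_b := congr1 snd eq_ab.
  by rewrite /rho eq_a eq_b.
- by apply: allpairs_uniq => [||[? ?] [? ?] _ _ [-> ->]]; rewrite ?msupp_uniq.
- move=> [a b] /allpairsP[[a' b'] /= [a_in b_in [-> ->]]].
  exact: (homog_pair_mem a_in b_in).
move=> [a b] notin; rewrite /G /=.
have [a_in|/memN_msupp_eq0->] := boolP (a \in msupp (fo (rpart mu))); last first.
  by rewrite !mul0r.
have [b_in|/memN_msupp_eq0->] := boolP (b \in msupp (fa (dpart mu))); last first.
  by rewrite !mul0r mulr0.
by case/negP: notin; apply/allpairsP; exists (a, b).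
Qed.

Lemma schur_coef_orthogonal lam lam' :
  \sum_mu (fj lam)@_(rho mu) * (fj lam')@_(rho mu) * ipw (@deg_join n) c1 (rho mu)
    = (lam == lam')%:R.
Proof.
have deg_gt0 := @deg_join_gt0 n.
have hom_lam := homog_vertex_fun C true deg_gt0 lam.
have le_n (mu : T) : (sumn mu <= n)%N by case: (intpartnP mu) => _ _ ->.
rewrite (@big_inj_support _ _ _ rho (msupp (fj lam))
   (fun m => (fj lam)@_m * (fj lam')@_m * ipw (@deg_join n) c1 m)) ?msupp_uniq //.
- rewrite -/(ip _ _ _ _).
  rewrite (vertex_fun_orthogonal (D := n) deg_gt0 (@count_deg_join C n))
    ?admissible_intpartn //.
  by rewrite expr1n -val_eqE; case: (_ == _).
- exact: rho_inj.
- move=> m m_in; apply: rho_surj; move/dhomogP: hom_lam => /(_ m m_in) /= ->.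
  by case: (intpartnP lam).
by move=> m /memN_msupp_eq0->; rewrite !mul0r.
Qed.

Variable A : 'M[C]_#|{: intpartn n}|.
Hypothesis A_expansion : is_mixed_expansion A.

(** The expansion is used at [N = 2n] only: the generators have degrees up to [2n], and that many
    variables make their power sums algebraically independent. *)
Lemma dilate_expansion lam :
  dilate (fj lam) = \sum_mu A (enum_rank lam) (enum_rank mu) *: mixed_fun mu.
Proof.
apply/subr0_eq/(@psum_subst_eq0 _ _ (@deg_join n) _ _ (n + n)%N).
- exact: deg_join_gt0.
- exact: deg_join_inj.
- exact: deg_join_leq.
have le_n (mu : T) : (sumn mu <= n)%N by case: (intpartnP mu) => _ _ ->.
have size_le s : all (leq 1) s -> (sumn s <= n)%N -> (size s <= n + n)%N.
  move=> /size_leq_sumn le_s le_sn; apply: leq_trans le_s (leq_trans le_sn _).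
  exact: leq_addr.
rewrite rmorphB /= -psum_subst_dilate; apply/eqP; rewrite subr_eq0; apply/eqP.
have := A_expansion lam (n + n)%N.
rewrite /schur_dup (schur_vertex_fun (D := n) (@deg_join_gt0 n) (@count_deg_join C n))
  ?intpartn_gt0 //; last first.
  by rewrite (leq_trans (size_le _ (intpartn_gt0 lam) (le_n lam))) // leq_addr.
rewrite psum_subst_comp => eq_A.
apply/eqP; rewrite -tofrac_eq; apply/eqP; rewrite eq_A.
have -> : psum_subst (@deg_join n) (fun i : 'I_(n + n) => 'X_i)
      (\sum_mu A (enum_rank lam) (enum_rank mu) *: mixed_fun mu)
    = \sum_mu psum_subst (@deg_join n) (fun i : 'I_(n + n) => 'X_i)
        (A (enum_rank lam) (enum_rank mu) *: mixed_fun mu).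
  exact: rmorph_sum.
rewrite [RHS]rmorph_sum; apply: eq_bigr => mu _.
case: (intpartnP mu) => _ mu0 _.
rewrite /= psum_substZ -mul_mpolyC [RHS]rmorphM -mulrA; congr (_ * _).
have /andP[_ r_gt0] := admissible_rpart mu0.
have /andP[_ d_gt0] := admissible_dpart mu.
rewrite (schurQ_vertex_fun (D := n) deg_odd_gt0 (@count_deg_odd C n))
  ?size_le ?sumn_rpart_leq ?admissible_rpart //.
rewrite /schur_sq (schur_vertex_fun (D := n) deg_all_gt0 (@count_deg_all C n))
  ?size_le ?sumn_dpart_leq //.
have sq_tuple : tnth [tuple ('X_i : {mpoly C[n + n]}) ^+ 2 | i < n + n]
    =1 fun i => 'X_i ^+ 2.
  by move=> i; rewrite tnth_mktuple.
rewrite psum_subst_comp (eq_psum_subst _ _ sq_tuple).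
by rewrite /mixed_fun psum_subst_pjoin [RHS]rmorphM /=.
Qed.

Lemma expansion_coef lam nu :
  \sum_mu A (enum_rank lam) (enum_rank mu) * mixed_coef mu nu
    = 2 ^+ mdeg (rho nu) * (fj lam)@_(rho nu).
Proof.
rewrite -mcoeff_dilate dilate_expansion raddf_sum; apply: eq_bigr => mu _ /=.
by rewrite mcoeffZ mcoeff_mixed_fun.
Qed.

Let w4 nu : C := ipw (@deg_join n) 4%:R (rho nu).

Lemma ipw_two nu : ipw (@deg_join n) c2 (rho nu) = w4 nu * 2 ^+ mdeg (rho nu).
Proof.
have two_neq0 : 2%:R != 0 :> C by rewrite pnatr_eq0.
apply: (mulIf (expf_neq0 (mdeg (rho nu)) two_neq0)).
rewrite (_ : (2 - false)%:R = 2%:R) // ipw_scale // -mulrA -exprMn -natrM.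
by rewrite ipw_scale // pnatr_eq0.
Qed.

(** The two factors [2 ^+ mdeg] combine to [4 ^+ mdeg], the ratio of the monomial norms for <,>_1
    and <,>_4. *)
Lemma expansion_orthogonal lam lam' :
  \sum_nu (2 ^+ mdeg (rho nu) * (fj lam)@_(rho nu))
      * (2 ^+ mdeg (rho nu) * (fj lam')@_(rho nu)) * w4 nu = (lam == lam')%:R.
Proof.
rewrite -schur_coef_orthogonal; apply: eq_bigr => nu _.
rewrite (_ : (2 - true)%:R = 1) // -(@ipw_scale _ _ _ 4%:R) ?pnatr_eq0 //.
by rewrite -/(w4 nu) (_ : 4%:R = 2 * 2) ?exprMn -?natrM //; ring.
Qed.

(* The Gram matrix of the Q_(mu^r) S_(mu^d) for the form <,>_4. Its inverse is
   A^T A because A expands an orthonormal basis in these functions. *)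
Definition gram : 'M[C]_#|{: T}| := \matrix_(i, j)
  \sum_nu mixed_coef (enum_val i) nu * mixed_coef (enum_val j) nu * w4 nu.

Lemma gram_inv : gram *m (A^T *m A) = 1%:M.
Proof.
pose M : 'M[C]_#|{: T}| := \matrix_(i, j) mixed_coef (enum_val i) (enum_val j).
pose W : 'M[C]_#|{: T}| := diag_mx (\row_j w4 (enum_val j)).
have sumE (G : T -> C) : \sum_(j < #|{: T}|) G (enum_val j) = \sum_x G x.
  rewrite (reindex (@enum_rank T)) /=; last exact/onW_bij/enum_rank_bij.
  by apply: eq_bigr => x _; rewrite enum_rankK.
have MW i j : (M *m W) i j = mixed_coef (enum_val i) (enum_val j) * w4 (enum_val j).
  by rewrite mul_mx_diag !mxE.
have gramE : gram = M *m W *m M^T.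
  apply/matrixP => i j; rewrite [RHS]mxE mxE -sumE; apply: eq_bigr => k _.
  by rewrite MW !mxE mulrAC.
have AM i j : (A *m M) i j
    = 2 ^+ mdeg (rho (enum_val j)) * (fj (enum_val i))@_(rho (enum_val j)).
  rewrite -expansion_coef mxE -sumE; apply: eq_bigr => k _.
  by rewrite mxE !enum_valK.
(* Orthonormality of the doubled Schur functions; as the matrices are square, [A] may then be moved
   to the other end of the product. *)
have AGA : A *m (gram *m A^T) = 1%:M.
  rewrite gramE !mulmxA -(mulmxA _ M^T) -trmx_mul.
  apply/matrixP => i j; rewrite mxE.
  have -> : (A *m M *m W) = \matrix_(i, k) ((A *m M) i k * w4 (enum_val k)).
    by rewrite mul_mx_diag; apply/matrixP => a b; rewrite !mxE.
  transitivity ((enum_val i == enum_val j)%:R : C); last first.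
    by rewrite (inj_eq enum_val_inj) mxE.
  rewrite -expansion_orthogonal -sumE; apply: eq_bigr => k _.
  by rewrite [X in X * _]mxE [X in _ * X]mxE !AM mulrAC.
by rewrite mulmxA; apply: mulmx1C.
Qed.

End MixedExpansion.

Section BlockDeterminant.
Variables (C : numClosedFieldType) (n0 n1 : nat).
Local Notation n := (n0 + 2 * n1)%N.
Local Notation T := (intpartn n).
Local Notation P := (block_parts n0 n1).
Implicit Types (lam mu : T).

(** The Q-factor is homogeneous of degree [sumn (rpart mu)] and the Schur factor of degree
    [sumn (dpart mu)], so every monomial that occurs has the same pair of degrees. *)
Lemma mixed_coef_block mu nu : (mu \in P) != (nu \in P) ->
  mixed_coef C mu nu = 0.
Proof.
case: (intpartnP mu) (intpartnP nu) => _ mu0 _ [_ nu0 nu_n] ne_P.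
have hom_o := homog_vertex_fun C false (@deg_odd_gt0 n) (rpart mu).
have hom_a := homog_vertex_fun C true (@deg_all_gt0 n) (dpart mu).
rewrite /mixed_coef.
have [eq_r|ne_r] := eqVneq (sumn (rpart nu)) (sumn (rpart mu)); last first.
  by rewrite (dhomog_nemf_coeff hom_o) ?mul0r //= weight_oddmult.
have [eq_d|ne_d] := eqVneq (sumn (dpart nu)) (sumn (dpart mu)); last first.
  by rewrite (dhomog_nemf_coeff hom_a) ?mulr0 //= weight_halfmult.
by rewrite !inE eq_r eq_d eqxx in ne_P.
Qed.

Variable A : 'M[C]_#|{: T}|.
Hypothesis A_expansion : is_mixed_expansion A.

(** The block is inverse to [M *m W4 *m M^T], while [M *m W2 *m M^T] is diagonal with entries
    [2 ^+ size (rpart lam)]. Eliminating [\det M] leaves [\det W2 / \det W4]. *)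
Lemma det_block :
  \det (submx_on P (A^T *m A)) * \prod_(lam in P) 2 ^+ size (rpart lam)
    = \prod_(lam in P) 2 ^+ mdeg (rho lam).
Proof.
pose w4 nu : C := ipw (@deg_join n) 4%:R (rho nu).
pose M : 'M[C]_#|P| := \matrix_(i, j) mixed_coef C (enum_val i) (enum_val j).
pose W4 : 'M[C]_#|P| := diag_mx (\row_j w4 (enum_val j)).
pose W2 : 'M[C]_#|P| :=
  diag_mx (\row_j (w4 (enum_val j) * 2 ^+ mdeg (rho (enum_val j)))).
have sumE (i : 'I_#|P|) (G : T -> C) :
    (forall nu, nu \notin P -> G nu = 0) ->
    \sum_nu G nu = \sum_(k < #|P|) G (enum_val k).
  move=> G0; rewrite (bigID (mem P)) /= [X in _ + X]big1 ?addr0 //.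
  exact: big_enum_val.
have MWM (v : T -> C) i j :
    (M *m diag_mx (\row_j v (enum_val j)) *m M^T) i j
    = \sum_nu mixed_coef C (enum_val i) nu * mixed_coef C (enum_val j) nu * v nu.
  rewrite (sumE i) => [|nu nPnu]; last first.
    by rewrite mixed_coef_block ?mul0r // enum_valP (negbTE nPnu).
  rewrite mul_mx_diag mxE; apply: eq_bigr => k _.
  by rewrite !mxE mulrAC.
have gram_sub : submx_on P (gram C n) = M *m W4 *m M^T.
  by apply/matrixP => i j; rewrite MWM !mxE !enum_rankK.
have W2_sub : M *m W2 *m M^T
    = diag_mx (\row_(i < #|P|) 2 ^+ size (rpart (enum_val i))).
  apply/matrixP => i j; rewrite (MWM (fun nu => w4 nu * 2 ^+ mdeg (rho nu))).
  under eq_bigr do rewrite -ipw_two.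
  rewrite mixed_coef_orthogonal !mxE (inj_eq enum_val_inj).
  by case: eqP => [->|_]; rewrite ?mulr1n ?mulr0n.
have detP (v : T -> C) : \det (diag_mx (\row_(j < #|P|) v (enum_val j)))
    = \prod_(lam in P) v lam.
  by rewrite det_diag [RHS]big_enum_val; apply: eq_bigr => k _; rewrite mxE.
have := congr1 (submx_on P) (gram_inv A_expansion).
rewrite submx_on_mul => [|x y Px nPy]; last first.
  rewrite mxE !enum_rankK big1 // => nu _.
  have [Pnu|nPnu] := boolP (nu \in P).
    by rewrite (mixed_coef_block (mu := y)) ?mulr0 ?mul0r // (negbTE nPy) Pnu.
  by rewrite mixed_coef_block ?mul0r // Px (negbTE nPnu).
rewrite gram_sub submx_on1 => /(congr1 determinant).
rewrite !det_mulmx det1 det_tr (detP w4) => det_W4.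
have /(congr1 determinant) := W2_sub.
rewrite !det_mulmx det_tr (detP (fun lam => 2 ^+ size (rpart lam))).
rewrite (detP (fun nu => w4 nu * 2 ^+ mdeg (rho nu))) big_split /= => det_W2.
rewrite -[RHS]mul1r -[X in _ = X * _]det_W4 -det_W2; ring.
Qed.

End BlockDeterminant.

Theorem theorem4p8 (C : numClosedFieldType) (n0 n1 : nat)
    (A : 'M[C]_#|{: intpartn (n0 + 2 * n1)}|) :
  is_mixed_expansion A ->
  `|\det (submx_on (block_parts n0 n1) (A^T *m A))| =
  2 ^ (\sum_(lam in block_parts n0 n1)
         ((size (glaisher (rpart lam)))%:Z + (size (dpart lam))%:Z
          - (size (rpart lam))%:Z)).
Proof.
move=> A_expansion; have two_neq0 : 2 != 0 :> C by rewrite pnatr_eq0.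
have prod_neq0 : \prod_(lam in block_parts n0 n1) 2 ^+ size (rpart lam) != 0 :> C.
  by apply/prodf_neq0 => lam _; apply: expf_neq0.
(* The determinant itself equals this nonnegative power, so the absolute value disappears. *)
suff -> : \det (submx_on (block_parts n0 n1) (A^T *m A)) =
    2 ^ (\sum_(lam in block_parts n0 n1)
         ((size (glaisher (rpart lam)))%:Z + (size (dpart lam))%:Z
          - (size (rpart lam))%:Z)).
  by rewrite ger0_norm // exprz_ge0 // ler0n.
apply: (mulIf prod_neq0); rewrite det_block //.
rewrite (big_morph (fun z : int => 2 ^ z) (id1 := 1) (op1 := *%R)); first last.
- exact: expr0z.
- by move=> a b; apply: expfzDr.
rewrite -big_split; apply: eq_bigr => lam _ /=.
case: (intpartnP lam) => _ lam0 lam_n.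
rewrite mdeg_mjoin mdeg_oddmult // mdeg_halfmult //.
by rewrite -[_ ^+ size _]/(_ ^ (size (rpart lam))%:Z) -expfzDr // subrK -PoszD.
Qed.
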